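(* For every integer $h\ge1$ there exists an oracle $\mathcal{A}$ such that $R^{p}_{dtt}(\mathrm{UP}_{\le h}^{\mathcal{A}})\not\subseteq R^{p,\mathcal{A}}_{s,b}(\mathrm{Promise\text{-}UP}^{\mathrm{U}\Sigma^{p,\mathcal{A}}_{h-1}})$.
   Context: Alphabet $\{0,1\}$. $\mathrm{UP}_{\le h}^{A}$: sets accepted by a nondeterministic polynomial-time oracle Turing machine with oracle $A$ having at most $h$ accepting paths on every input. A $\Sigma_j(A)$-system $[A;N_1,\dots,N_j]$ consists of $A$ and nondeterministic polynomial-time oracle Turing machines; its language is $L[A;N_1]=L(N_1^A)$ and $L[A;N_1,\dots,N_j]=L(N_1^{L[A;N_2,\dots,N_j]})$; its computation on $x$ is that of $N_1$ on $x$ with oracle $A$ ($j=1$) or $L[A;N_2,\dots,N_j]$ ($j>1$); it is unambiguous if for every $1\le i\le j$ and every input $y$, $[A;N_i,\dots,N_j](y)$ has at most one accepting path. $\mathrm{U}\Sigma^{p,A}_0=\mathrm{P}^A$ and $\mathrm{U}\Sigma^{p,A}_j$ ($j\ge1$) is the class of languages of unambiguous $\Sigma_j(A)$-systems. A promise problem $\Pi=(\Pi_{yes},\Pi_{no})$ is a pair of disjoint sets; $\mathrm{Promise\text{-}UP}^{\mathcal{C}}$ is the class of promise problems $\Pi$ for which there exist $D\in\mathcal{C}$ and a nondeterministic polynomial-time oracle machine $N$ with $N^D(x)$ having exactly one accepting path for $x\in\Pi_{yes}$ and none for $x\in\Pi_{no}$. $R^{p,A}_{s,b}$ of a class of promise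 problems: sets $L$ for which there are a promise problem $\Pi$ in the class, a constant $c$, and a deterministic polynomial-time oracle machine $M$ with access to $A$ and $\Pi$ that on every input asks at most $c$ (adaptive) queries to $\Pi$, each in $\Pi_{yes}\cup\Pi_{no}$, and accepts exactly $L$. $R^p_{dtt}(\mathcal{C})$: sets $L$ for which there are $D\in\mathcal{C}$ and a polynomial-time computable map from $x$ to a finite list of strings such that $x\in L$ iff some listed string is in $D$. *)

(* Defs.v *)
From HB Require Import structures.
From mathcomp Require Import all_boot.
From mathcomp Require Import boolp classical_sets functions cardinality.

Set Implicit Arguments.
Unset Strict Implicit.
Unset Printing Implicit Defensive.

Local Open Scope classical_set_scope.

Definition word := seq bool.
Definition language := set word.

(* ------------------------------------------------------------------------ *)
(* Nondeterministic multitape oracle Turing machines.                       *)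
(*                                                                          *)
(* The work tapes are two-way infinite; tape 0 initially holds the input.   *)
(* There is one write-only query tape, shared by the oracles (indexed by    *)
(* I), which is erased by each query, and one write-only output tape.       *)
(* States and extra tape symbols are numbered, so that machines are finite  *)
(* objects and form a countable type when I is finite.                      *)
(* ------------------------------------------------------------------------ *)

Variant move := Stay | Leftward | Rightward.

Definition move_code (d : move) : option bool :=
  match d with Stay => None | Leftward => Some false | Rightward => Some true end.
Definition move_decode (o : option bool) : move :=
  match o with None => Stay | Some false => Leftward | Some true => Rightward end.
Lemma move_codeK : cancel move_code move_decode. Proof. by case. Qed.
HB.instance Definition _ := Finite.copy move (can_type move_codeK).

(* None is the blank, Some (inl b) the bit b *)
Definition cell (a : nat) : finType := option (bool + 'I_a).

Record otm (I : finType) := OTM {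
  nstates : nat;
  ntapes : nat; (* number of work tapes besides tape 0 *)
  nextra : nat;
  start : 'I_nstates;
  final : {set 'I_nstates};
  (* [query q = Some (i, (q1, q0))]: in state q, oracle i is asked about the
     word on the query tape; the new state is q1 on answer yes, q0 on no *)
  query : {ffun 'I_nstates -> option (I * ('I_nstates * 'I_nstates))};
  (* the possible actions in a non-query state, given the scanned symbols: new
     state; symbol written and move on each work tape; bit appended to the
     query tape, if any; symbol appended to the output tape, if any *)
  delta : {ffun 'I_nstates * {ffun 'I_ntapes.+1 -> cell nextra} ->
           {set 'I_nstates * {ffun 'I_ntapes.+1 -> cell nextra * move} *
                option bool * option (option bool)}}
}.

(* cells left of the head, nearest first; scanned cell; cells right of it;
   everything beyond the two lists is blank *)
Definition tape (a : nat) : eqType := (seq (cell a) * cell a * seq (cell a))%type.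

Definition scanned a (t : tape a) : cell a := t.1.2.

Definition blank_tape a : tape a := ([::], None, [::]).

Definition input_tape a (x : word) : tape a :=
  if x is b :: y then ([::], Some (inl b), [seq Some (inl c) | c <- y])
  else blank_tape a.

Definition write_move a (t : tape a) (sd : cell a * move) : tape a :=
  let: (l, _, r) := t in
  let: (s, d) := sd in
  match d with
  | Stay => (l, s, r)
  | Leftward => (behead l, head None l, s :: r)
  | Rightward => (s :: l, head None r, behead r)
  end.

Section Computation.
Variables (I : finType) (M : otm I).

Notation action := ('I_(nstates M) *
  {ffun 'I_(ntapes M).+1 -> cell (nextra M) * move} *
  option bool * option (option bool))%type.

(* state, work tapes, query tape, output tape *)
Definition config : eqType :=
  ('I_(nstates M) * {ffun 'I_(ntapes M).+1 -> tape (nextra M)} *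
   word * seq (option bool))%type.

Definition cstate (c : config) : 'I_(nstates M) := c.1.1.1.
Definition coutput (c : config) : seq (option bool) := c.2.

Definition init (x : word) : config :=
  (start M, [ffun i => if i == ord0 then input_tape _ x else blank_tape _],
   [::], [::]).

Definition act (c : config) (m : action) : config :=
  let: (_, ts, w, o) := c in
  let: (q, sd, wb, ob) := m in
  (q, [ffun i => write_move (ts i) (sd i)],
   w ++ seq_of_opt wb, o ++ seq_of_opt ob).

Definition successors (O : I -> language) (c : config) : seq config :=
  let: (q, ts, w, o) := c in
  if query M q is Some (i, (q1, q0)) then
    [:: (if `[< O i w >] then q1 else q0, ts, [::], o)]
  else [seq act c m | m <- enum (delta M (q, [ffun i => scanned (ts i)]))].

Definition step (O : I -> language) : rel config :=
  fun c c' => c' \in successors O c.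

Definition halted (O : I -> language) (c : config) : bool := nilp (successors O c).

(* [p] lists the configurations after the initial one *)
Definition computation (O : I -> language) (x : word) (p : seq config) : bool :=
  path (step O) (init x) p.

Definition accepting_paths (O : I -> language) (x : word) : set (seq config) :=
  [set p | [/\ computation O x p, halted O (last (init x) p)
             & cstate (last (init x) p) \in final M]].

Definition accepted (O : I -> language) : language :=
  [set x | accepting_paths O x !=set0].

Definition queries (i : I) (cs : seq config) : seq word :=
  pmap (fun c : config => let: (q, _, w, _) := c in
          if query M q is Some (j, _) then if j == i then Some w else None
          else None) cs.

Definition deterministic : Prop := forall qs, #|delta M qs| <= 1.

(* n ^ k + k, k : nat, dominate all polynomials; as usual for oracle machines
   the running time is bounded independently of the oracles *)
Definition polytime : Prop :=
  exists k : nat, forall (O : I -> language) (x : word) (p : seq config),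
    computation O x p -> size p <= size x ^ k + k.

End Computation.

Arguments successors {I} M O c.
Arguments step {I} M O.
Arguments halted {I} M O c.
Arguments computation {I} M O x p.
Arguments accepting_paths {I} M O x.
Arguments accepted {I} M O.
Arguments queries {I} M i cs.

Record nptm (I : finType) := NPTM {
  machine :> otm I;
  nptm_polytime : polytime machine
}.

Definition paths1 (N : nptm unit) (A : language) (x : word) :
  set (seq (config N)) := accepting_paths N (fun=> A) x.
Definition lang1 (N : nptm unit) (A : language) : language :=
  accepted N (fun=> A).
Arguments paths1 : clear implicits.

Definition relP (A : language) : set language :=
  [set L | exists N : nptm unit, deterministic N /\ lang1 N A = L].

Definition UPle (h : nat) (A : language) : set language :=
  [set L | exists N : nptm unit,
     (forall x, (paths1 N A x #<= `I_h)%card) /\ lang1 N A = L].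

(* The system [A; N_1, ..., N_j], with Ns = [:: N_1; ...; N_j]; as a
   convention, the language of the empty system is A. *)
Fixpoint sys_lang (A : language) (Ns : seq (nptm unit)) : language :=
  if Ns is N :: Ns' then lang1 N (sys_lang A Ns') else A.

Fixpoint unambiguous (A : language) (Ns : seq (nptm unit)) : Prop :=
  if Ns is N :: Ns' then
    (forall y, is_subset1 (paths1 N (sys_lang A Ns') y)) /\ unambiguous A Ns'
  else True.

Definition USigma (j : nat) (A : language) : set language :=
  if j is 0 then relP A
  else [set L | exists Ns : j.-tuple (nptm unit),
                  unambiguous A Ns /\ sys_lang A Ns = L].

Record promise_problem := PromiseProblem {
  pyes : language;
  pno : language;
  pdisjoint : pyes `&` pno = set0
}.

Definition PromiseUP (C : set language) : set promise_problem :=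
  [set Pi | exists2 D, C D & exists N : nptm unit,
     (forall x, pyes Pi x -> exists! p, paths1 N D x p) /\
     (forall x, pno Pi x -> paths1 N D x = set0)].

(* A machine with access to A and Pi is an [nptm bool]: oracle [true] is A and
   oracle [false] is Pi, which answers membership in [pyes Pi]; the answers
   outside the promise are irrelevant in [Rsb]. *)
Definition with_promise (A : language) (Pi : promise_problem) (i : bool) :
  language := if i then A else pyes Pi.

Definition Rsb (A : language) (K : set promise_problem) : set language :=
  [set L | exists2 Pi, K Pi & exists (c : nat) (M : nptm bool),
     [/\ deterministic M,
         forall x p, computation M (with_promise A Pi) x p ->
           let qs := queries M false (init M x :: p) in
           size qs <= c /\ (forall w, w \in qs -> (pyes Pi `|` pno Pi) w)
       & accepted M (with_promise A Pi) = L]].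

(* On the output tape, None ends each word of the list. *)
Definition encode_words (ws : seq word) : seq (option bool) :=
  flatten [seq rcons [seq Some b | b <- w] None | w <- ws].

Definition polytime_computable (f : word -> seq word) : Prop :=
  exists2 M : nptm void, deterministic M &
    forall x, exists p, let c := last (init M x) p in
      [/\ computation M (fun=> set0) x p, halted M (fun=> set0) c
        & coutput c = encode_words (f x)].

Definition Rdtt (C : set language) : set language :=
  [set L | exists2 D, C D & exists2 f, polytime_computable f &
     forall x, L x <-> exists2 w, w \in f x & D w].

(* Main.v *)
Require Import Defs.
From mathcomp Require Import all_boot.
From mathcomp Require Import boolp classical_sets cardinality.
From mathcomp Require Import zify.

(** The oracle [A] has at most [h] words of each length, so that
    [{w | some word of A has length |w|}] is in [UP_{<=h}^A], and the language to be
    separated is [{x | A has a word of length |w| for some w listed by x}].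

    Fix machines [Ns = N_1, ..., N_(h-1)] (or one deterministic machine if
    [h = 1]), [N] and [M], and suppose that no finite extension of the current initial
    segment of [A] defeats them.  Call a word [x] exceptional for an input [y] if
    adding [x] to the oracle changes the answer of a system of [k] unambiguous
    machines on [y].  By induction on [k], only polynomially many words of length [m]
    are exceptional as long as at most [h - k - 1] words of length [m] are
    present: two words outside each other's computations would yield two
    accepting paths once both are added.  In particular the oracle of [N] is stable
    when the first word of any length is added.

    If [M] makes at most [c] queries, pick one word for each of [c + 1] lengths
    such that none is exceptional for the computations on the oracles obtained
    by adding some of the others (a random choice works).  Then adding words can
    only turn answers to the queries of [M] from no to yes, and no query can be
    turned into yes by each of two words separately and still be asked when both are
    present.  This leaves room for the addition of at most [c] words to change the
    computation of [M], whereas each of the [c + 1] additions must. *)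

Set Implicit Arguments.
Unset Strict Implicit.
Unset Printing Implicit Defensive.

Local Open Scope classical_set_scope.

(** * Counting *)

(** A cardinality bound through duplicate-free lists, which applies to undecidable predicates on
    infinite types. *)
Definition small (T : eqType) (P : T -> Prop) (n : nat) : Prop :=
  forall s : seq T, uniq s -> (forall x, x \in s -> P x) -> size s <= n.

Section Small.
Variable T : eqType.
Implicit Types P Q : T -> Prop.

Lemma small_sub P Q n m :
  (forall x, P x -> Q x) -> n <= m -> small Q n -> small P m.
Proof.
move=> PQ nm Qn s us sP; apply: leq_trans nm.
by apply: Qn => // x /sP; apply: PQ.
Qed.

Lemma small_or P Q n m :
  small P n -> small Q m -> small (fun x => P x \/ Q x) (n + m).
Proof.
move=> Pn Qm s us sPQ; rewrite -(count_predC (fun x => `[< P x >]) s).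
rewrite -!size_filter; apply: leq_add.
  by apply: Pn => [|x]; rewrite ?filter_uniq// mem_filter => /andP[/asboolP].
apply: Qm => [|x]; rewrite ?filter_uniq// mem_filter => /andP[/asboolPn nP].
by move=> /sPQ[].
Qed.

Lemma small_false n : small (fun _ : T => False) n.
Proof. by case=> [//|x s] _ /(_ x (mem_head _ _)). Qed.

Lemma small_eq (y : T) : small (fun x => x = y) 1.
Proof.
move=> [|x [|z s]] //= /andP[]; rewrite inE negb_or => /andP[/eqP xz _] _ h.
by case: xz; rewrite (h x) ?mem_head// (h z)// !inE eqxx orbT.
Qed.

Lemma small_mem (s : seq T) : small (fun x => x \in s) (size s).
Proof. by move=> t ut ts; apply: uniq_leq_size. Qed.

Lemma small_exists_seq (K : eqType) (R : K -> T -> Prop) (l : seq K) e :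
  (forall k, k \in l -> small (R k) e) ->
  small (fun x => exists2 k, k \in l & R k x) (size l * e).
Proof.
elim: l => [|k l IH] Re.
  by apply: small_sub (small_false 0) => // x [].
have IHl : small (fun x => exists2 k, k \in l & R k x) (size l * e).
  by apply: IH => k' k'l; apply: Re; rewrite inE k'l orbT.
apply: small_sub (small_or (Re k (mem_head _ _)) IHl); last by rewrite mulSn.
move=> x [k']; rewrite inE => /orP[/eqP -> Rk|k'l Rk]; first by left.
by right; exists k'.
Qed.

Lemma small_exists (K : finType) (R : K -> T -> Prop) e :
  (forall k, small (R k) e) -> small (fun x => exists k, R k x) (#|K| * e).
Proof.
move=> Re; have := @small_exists_seq _ R (enum K) e (fun k _ => Re k).
rewrite -cardE; apply: small_sub => // x [k Rk].
by exists k => //; rewrite mem_enum.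
Qed.

(* Double counting: the [n * (n - 1)] ordered pairs are covered by the relation
   and its converse, which contain at most [n * d] pairs each. *)
Lemma small_tournament P (r : T -> T -> Prop) d :
  (forall x, P x -> small (fun y => P y /\ r x y) d) ->
  (forall x y, P x -> P y -> x != y -> r x y \/ r y x) ->
  small P (2 * d).+1.
Proof.
move=> rd tot s us sP; set n := size s.
pose b x y := `[< r x y >].
have cE (a : pred T) : count a s = \sum_(y <- s) a y.
  by rewrite -sum1_count big_mkcond; apply: eq_bigr => y _; case: (a y).
have out x : x \in s -> count (b x) s <= d.
  move=> xs; rewrite -size_filter; apply: (rd x (sP _ xs)); first exact: filter_uniq.
  by move=> y; rewrite mem_filter => /andP[/asboolP rxy /sP].
have sum_out : \sum_(x <- s) count (b x) s <= n * d.
  rewrite big_seq (leq_trans (leq_sum _ out))// -big_seq.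
  by rewrite big_const_seq count_predT iter_addn addn0 mulnC.
have sum_in : \sum_(x <- s) count (b^~ x) s = \sum_(x <- s) count (b x) s.
  under eq_bigr do rewrite cE.
  by rewrite exchange_big; apply: eq_bigr => x _; rewrite cE.
have pairs x : x \in s -> n.-1 <= count (b x) s + count (b^~ x) s.
  move=> xs; rewrite -count_predUI.
  have -> : n.-1 = count (predC (pred1 x)) s.
    by rewrite /n -(count_predC (pred1 x)) (count_uniq_mem _ us) xs.
  apply: leq_trans (leq_addr _ _); rewrite -!size_filter.
  apply: uniq_leq_size; first exact: filter_uniq.
  move=> y; rewrite !mem_filter /= => /andP[yx ys]; rewrite ys andbT.
  have [|rxy|ryx] := tot x y (sP _ xs) (sP _ ys); first by rewrite eq_sym.
    by rewrite /b asboolT.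
  by rewrite /b (asboolT ryx) orbT.
have : n * n.-1 <= 2 * (n * d).
  have -> : n * n.-1 = \sum_(x <- s) n.-1.
    by rewrite big_const_seq count_predT iter_addn addn0 mulnC.
  rewrite big_seq (leq_trans (leq_sum _ pairs))// -big_seq big_split /= sum_in.
  by rewrite addnn -mul2n leq_mul2l.
case: n {out sum_out pairs} => [//|n]; rewrite mulnCA leq_mul2l /=; lia.
Qed.

End Small.

Arguments small_eq {T} y _ _ _.
Arguments small_mem {T} s _ _ _.

(** * Locality of computations *)

#[local] Arguments queries : simpl never.

Section Locality.
Variables (I : finType) (M : otm I).
Implicit Types (O : I -> language) (c : config M) (p : seq (config M)).

Definition cword c : word := c.1.2.

Definition asked c : option (I * word) :=
  if query M (cstate c) is Some (j, _) then Some (j, cword c) else None.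

Lemma mem_queries i w p :
  reflect (exists2 c, c \in p & asked c = Some (i, w)) (w \in queries M i p).
Proof.
rewrite mem_pmap; apply: (iffP mapP) => [[[[[q ts] v] o] cp]|[[[[q ts] v] o] cp]].
  move=> e; exists (q, ts, v, o) => //; move: e; rewrite /asked /cstate /cword /=.
  by case: (query M q) => [[j [q1 q0]]|//]; case: eqP => [->|//] [->].
rewrite /asked /cstate /cword /= => e; exists (q, ts, v, o) => //=.
by move: e; case: (query M q) => [[j [q1 q0]]|//] [-> ->]; rewrite eqxx.
Qed.

Lemma size_queries i p : size (queries M i p) <= size p.
Proof. by rewrite size_pmap; exact: count_size. Qed.

Definition agree_on O O' p : Prop :=
  forall i w, w \in queries M i p -> (O i w <-> O' i w).

Lemma agree_onS O O' p p' :
  {subset p' <= p} -> agree_on O O' p -> agree_on O O' p'.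
Proof.
move=> sub ag i w /mem_queries[c cp e]; apply: ag.
by apply/mem_queries; exists c => //; apply: sub.
Qed.

Lemma agree_on_sym O O' p : agree_on O O' p -> agree_on O' O p.
Proof. by move=> ag i w /ag[? ?]; split. Qed.

Lemma successors_local O O' c :
  agree_on O O' [:: c] -> successors M O c = successors M O' c.
Proof.
case: c => [[[q ts] w] o] ag; rewrite /successors.
case e: (query M q) => [[i [q1 q0]]|//].
suff -> : `[< O i w >] = `[< O' i w >] by [].
apply: asbool_equiv_eq; apply: ag; apply/mem_queries.
by exists (q, ts, w, o); rewrite ?mem_head// /asked /= e.
Qed.

Lemma path_local O O' c p :
  agree_on O O' (c :: p) -> path (step M O) c p -> path (step M O') c p.
Proof.
elim: p c => [//|c' p IH] c ag /= /andP[st pp].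
rewrite /step -(successors_local (O := O)); last first.
  by apply: agree_onS ag => d; rewrite !inE => /eqP ->; rewrite eqxx.
rewrite [_ \in _]st /=; apply: IH => //.
by apply: agree_onS ag => d dp; rewrite in_cons dp orbT.
Qed.

Lemma halted_local O O' c :
  agree_on O O' [:: c] -> halted M O c = halted M O' c.
Proof. by rewrite /halted => /successors_local ->. Qed.

Lemma accepting_paths_local O O' x p :
  agree_on O O' (init M x :: p) ->
  accepting_paths M O x p -> accepting_paths M O' x p.
Proof.
move=> ag [cp hp fp]; split=> //; first exact: path_local ag cp.
rewrite -(halted_local (O := O)) //.
by apply: agree_onS ag => d; rewrite inE => /eqP ->; apply: mem_last.
Qed.

Lemma cword_step O c c' : step M O c c' -> size (cword c') <= (size (cword c)).+1.
Proof.
case: c => [[[q ts] w] o]; rewrite /step /successors.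
case e: (query M q) => [[i [q1 q0]]|]; first by rewrite inE => /eqP ->.
case/mapP => [[[[q' sd] wb] ob]] _ ->; rewrite /act /cword /= size_cat.
by case: wb => //=; rewrite ?addn1 ?addn0.
Qed.

Lemma cword_path O c p c' : path (step M O) c p -> c' \in c :: p ->
  size (cword c') <= size (cword c) + size p.
Proof.
elim: p c => [|d p IH] c; first by rewrite inE => _ /eqP ->; rewrite addn0.
move=> /= /andP[/cword_step st /IH pp]; rewrite inE => /orP[/eqP ->|/pp].
  exact: leq_addr.
by move=> le; rewrite (leq_trans le)// addnS -addSn leq_add2r.
Qed.

Lemma size_query O x p i w : computation M O x p ->
  w \in queries M i (init M x :: p) -> size w <= size p.
Proof.
move=> cp /mem_queries[c cin]; rewrite /asked.
by case: (query M _) => [[j _]|//] [_ <-]; have := cword_path cp cin.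
Qed.

(** If no run halted, every run could be prolonged, past the time bound. *)
Lemma halted_exists O x : polytime M ->
  exists2 p, computation M O x p & halted M O (last (init M x) p).
Proof.
case=> k pk; apply: contrapT => nex.
suff ext n : exists2 p, computation M O x p & size p = n.
  have [p cp sp] := ext (size x ^ k + k).+1.
  by have := pk O x p cp; rewrite sp ltnn.
elim: n => [|n [p cp sp]]; first by exists [::].
case e: (successors M O (last (init M x) p)) => [|c cs].
  by case: nex; exists p => //; rewrite /halted e.
exists (rcons p c); last by rewrite size_rcons sp.
rewrite /computation rcons_path; apply/andP; split; first exact: cp.
by rewrite /step e mem_head.
Qed.

Lemma det_successors O c : deterministic M -> size (successors M O c) <= 1.
Proof.
case: c => [[[q ts] w] o] det; rewrite /successors.
by case: (query M q) => [[i [q1 q0]]|] //; rewrite size_map -cardE; apply: det.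
Qed.

Lemma det_halted_path O c p p' : deterministic M ->
  path (step M O) c p -> halted M O (last c p) ->
  path (step M O) c p' -> halted M O (last c p') -> p = p'.
Proof.
move=> det; elim: p c p' => [|d p IH] c [|d' p'] //=.
- by move=> _ /nilP h0 /andP[]; rewrite /step h0.
- by move=> /andP[st _] _ _ /nilP h0; move: st; rewrite /step h0.
move=> /andP[st pp] hp /andP[st' pp'] hp'.
have ed : d = d'.
  move: st st' (det_successors O c det); rewrite /step.
  case: (successors M O c) => [//|e [|//]].
  by rewrite !inE => /eqP -> /eqP ->.
by subst d'; rewrite (IH d p').
Qed.

(* First divergence of two runs of a deterministic machine: as long as the
   answers of oracle [i] agree, so do the queries made to it. *)
Lemma det_transcripts O O' i c p p' : deterministic M ->
  (forall j w, j != i -> w \in queries M j (c :: p) -> (O j w <-> O' j w)) ->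
  path (step M O) c p -> halted M O (last c p) ->
  path (step M O') c p' -> halted M O' (last c p') ->
  let qs := queries M i (c :: p) in let qs' := queries M i (c :: p') in
  let ans := [seq `[< O i w >] | w <- qs] in
  let ans' := [seq `[< O' i w >] | w <- qs'] in
  (forall t, take t ans = take t ans' -> take t.+1 qs = take t.+1 qs') /\
  (ans = ans' -> p = p').
Proof.
move=> det.
elim: p c p' => [|d p IH] c p' ag /=.
  move=> _ hc pp' hp'.
  have ag1 : agree_on O O' [:: c].
    move=> j w wq; have [ji|/ag] := eqVneq j i; last exact.
    move: wq hc; subst j => /mem_queries[c']; rewrite inE => /eqP -> {c'}.
    case: c {ag pp' hp'} => [[[q ts] v] o]; rewrite /asked /halted /successors /cstate /=.
    by case: (query M q) => [[j [q1 q0]]|].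
  have : p' = [::].
    case: p' pp' {hp'} => //= d p' /andP[]; rewrite /step -(successors_local ag1).
    by move/nilP: hc => ->.
  move=> -> /=; split=> // t _; congr take.
move=> /andP[st pp] hp pp' hp'.
case: p' pp' hp' => [|d' p'] /=.
  move=> _; case: c ag st {IH} => [[[q ts] w] o] ag; rewrite /step /successors /halted /successors.
  case: (query M q) => [[j [q1 q0]]|]; first by [].
  by move=> din /nilP E; rewrite E in din.
move=> /andP[st' pp'] hp'.
have agd j w : j != i -> w \in queries M j (d :: p) -> (O j w <-> O' j w).
  move=> ji /mem_queries[c' c'in e]; apply: ag => //; apply/mem_queries.
  by exists c' => //; rewrite inE c'in orbT.
have same : agree_on O O' [:: c] -> d = d'.
  move=> ag1; move: st st' (det_successors O c det); rewrite /step.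
  rewrite -(successors_local ag1); case: (successors M O c) => [//|e [|//]].
  by rewrite !inE => /eqP -> /eqP ->.
case eq: (asked c) => [[j w]|]; last first.
  have E : d = d'.
    apply: same => j w /mem_queries[c']; rewrite inE => /eqP ->.
    by rewrite eq.
  subst d'; have [IH1 IH2] := IH _ _ agd pp hp pp' hp'.
  have qe s : queries M i (c :: s) = queries M i s.
    case: c eq {ag st st' same} => [[[q ts] v] o]; rewrite /asked /cstate /cword /= /queries /=.
    by case: (query M q) => [[]|].
  rewrite !qe; split=> // e; congr cons; exact: IH2.
have qe s : queries M i (c :: s) = if j == i then w :: queries M i s else queries M i s.
  case: c eq {ag st st' same} => [[[q ts] v] o]; rewrite /asked /cstate /cword /= /queries /=.
  by case: (query M q) => [[j' [q1 q0]]|//] [-> ->]; case: ifP.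
have [ji|ji] := eqVneq j i; last first.
  have E : d = d'.
    apply: same => j' w' /mem_queries[c']; rewrite inE => /eqP ->.
    rewrite eq => -[<- <-]; apply: ag => //; apply/mem_queries.
    by exists c; rewrite ?mem_head.
  subst d'; have [IH1 IH2] := IH _ _ agd pp hp pp' hp'.
  rewrite !qe (negbTE ji); split=> // e; congr cons; exact: IH2.
subst j; rewrite !qe !eqxx /=.
have same' : `[< O i w >] = `[< O' i w >] -> d = d'.
  move=> E; have e := asbool_eq_equiv E; apply: same => j' w' /mem_queries[c'].
  by rewrite inE => /eqP ->; rewrite eq => -[<- <-].
split=> [[|t]|].
- by rewrite !take0.
- rewrite /= => -[/same' E]; subst d'.
  by have [IH1 IH2] := IH _ _ agd pp hp pp' hp' => /IH1 ->.
- move=> [/same' E]; subst d'.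
  by have [IH1 IH2] := IH _ _ agd pp hp pp' hp' => /IH2 ->.
Qed.

End Locality.

(** * Polynomial bounds, and oracles that agree on short words *)

Lemma leq_exp_l m n k : m <= n -> m ^ k <= n ^ k.
Proof. by move=> mn; elim: k => // k IH; rewrite !expnS leq_mul. Qed.

(** The base [n.+2] is at least 2, so one more factor absorbs the additive constant. Bounds of this
    shape are closed under products and, by the next lemma, under composition. *)
Lemma pow_le_monomial n k : n ^ k + k <= n.+2 ^ k.+1.
Proof.
have h1 : n ^ k <= n.+2 ^ k by rewrite leq_exp_l //; lia.
have h2 : k <= n.+2 ^ k by rewrite (leq_trans (ltnW (ltn_expl k (ltnSn 1))))// leq_exp_l.
rewrite expnS; nia.
Qed.

Lemma pow_comp_monomial n j : (n ^ j + j).+2 <= n.+2 ^ j.+2.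
Proof.
have h := pow_le_monomial n j; rewrite expnS; set P := n.+2 ^ j.+1 in h *.
have P2 : 2 <= P by rewrite /P expnS (leq_trans _ (leq_pmulr _ _))// expn_gt0.
nia.
Qed.

Definition addw (A : language) (x : word) : language := A `|` [set x].

Definition agree (n : nat) (A A' : language) : Prop :=
  forall w, size w <= n -> (A w <-> A' w).

Lemma agreeW n m A A' : n <= m -> agree m A A' -> agree n A A'.
Proof. by move=> nm ag w wn; apply: ag; apply: leq_trans nm. Qed.

Lemma agree_refl n A : agree n A A.
Proof. by []. Qed.

Lemma agree_sym n A A' : agree n A A' -> agree n A' A.
Proof. by move=> ag w wn; apply: iff_sym; apply: ag. Qed.

Lemma agree_trans n A A' A'' : agree n A A' -> agree n A' A'' -> agree n A A''.
Proof. by move=> a b w wn; apply: (iff_trans (a w wn)); apply: b. Qed.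

Lemma agree_on_agree (I : finType) (M : otm I) (O O' : I -> language) x p n :
  computation M O x p -> size p <= n -> (forall i, agree n (O i) (O' i)) ->
  agree_on O O' (init M x :: p).
Proof.
move=> cp pn ag i w wq; apply: ag.
exact: leq_trans (size_query cp wq) pn.
Qed.

Lemma accepted_local (I : finType) (M : otm I) k (O O' : I -> language) n :
  (forall (O : I -> language) x p, computation M O x p -> size p <= size x ^ k + k) ->
  (forall i, agree (n ^ k + k) (O i) (O' i)) ->
  agree n (accepted M O) (accepted M O').
Proof.
move=> Mk.
suff half O1 O2 : (forall i, agree (n ^ k + k) (O1 i) (O2 i)) ->
    forall x, size x <= n -> accepted M O1 x -> accepted M O2 x.
  move=> ag x xn; split; first exact: half.
  by apply: half => // i; apply: agree_sym.
move=> ag x xn [p [cp hp fp]]; exists p.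
apply: accepting_paths_local (And3 cp hp fp).
apply: (agree_on_agree cp _ ag).
by rewrite (leq_trans (Mk _ _ _ cp))// leq_add2r leq_exp_l.
Qed.

(** The running time of each machine bounds the length of its queries, and these bounds compose down
    the system. *)
Lemma sys_lang_local Ns : exists g : nat -> nat, forall n A A',
  agree (g n) A A' -> agree n (sys_lang A Ns) (sys_lang A' Ns).
Proof.
elim: Ns => [|N Ns [g gP]]; first by exists id.
have [k Nk] := nptm_polytime N.
exists (fun n => g (n ^ k + k)) => n A A' ag /=.
by apply: accepted_local Nk _ => _; apply: gP.
Qed.

(** * Stability of unambiguous systems *)

Definition wle (A : language) (m r : nat) : Prop :=
  small (fun x : word => A x /\ size x = m) r.

Lemma wle_addw A m r x : wle A m r -> wle (addw A x) m r.+1.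
Proof.
move=> Ar; rewrite /wle -addn1; apply: small_sub (small_or Ar (small_eq x)) => //.
by move=> y [[Ay|->] ym]; [left|right].
Qed.

Arguments wle_addw {A m r} x _ _ _ _.

Lemma wle_addw_neq A m r x : size x <> m -> wle A m r -> wle (addw A x) m r.
Proof.
by move=> xm; apply: small_sub => // y [[Ay|->]].
Qed.

(* The finite oracles that may still occur once the words of length at most [l] have
   been fixed as in [B]. *)
Definition valid (h l : nat) (B A : language) : Prop :=
  [/\ exists n, forall w, A w -> size w <= n, agree l B A & forall m, wle A m h].

Lemma valid_addw h l B A m r x : valid h l B A -> l < m -> size x = m ->
  wle A m r -> r < h -> valid h l B (addw A x).
Proof.
move=> [[n An] ag Ah] lm xm Ar rh; split.
- exists (maxn n (size x)) => w [/An|->]; rewrite leq_max ?leqnn ?orbT//.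
  by move->.
- move=> w wl; apply: (iff_trans (ag w wl)); split; first by left.
  by case=> // wx; move: wl lm; rewrite wx xm; lia.
- move=> m'; have [<-|mm'] := eqVneq m m'.
    by apply: small_sub (wle_addw x Ar).
  by apply: wle_addw_neq => //; rewrite xm; apply/eqP.
Qed.

(** This says that [x] is exceptional for the input [y]; [F] maps an oracle to the language of a
    system over it. *)
Definition flip (F : language -> language) (A : language) (y x : word) : Prop :=
  ~ (F (addw A x) y <-> F A y).

Lemma paths1_flip (N : nptm unit) (F : language -> language) A A' y p :
  (forall w, w \in queries N tt (init N y :: p) -> (F A w <-> F A' w)) ->
  paths1 N (F A) y p -> paths1 N (F A') y p.
Proof. by move=> ag; apply: accepting_paths_local => -[] w /ag. Qed.

Lemma addwC A x z : addw (addw A x) z = addw (addw A z) x.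
Proof. by rewrite /addw -!setUA (setUC [set x]). Qed.

(* If [y] is accepted, an exceptional word is exceptional for a query on the
   accepting path.  If [y] is rejected and [x], [z] are exceptional, the accepting
   paths on [addw A x] and [addw A z] both survive on [addw (addw A x) z], unless [z]
   is exceptional for a query on the first or [x] for a query on the second. *)
Lemma sys_lang_stable h l B Ns :
  (forall A, valid h l B A -> unambiguous A Ns) ->
  exists k, forall A m r y, valid h l B A -> l < m -> wle A m r ->
    r + (size Ns).+1 <= h ->
    small (fun x : word => size x = m /\ flip (sys_lang^~ Ns) A y x)
          ((size y).+2 ^ k).
Proof.
elim: Ns => [|N Ns IH] unamb.
  exists 0 => A m r y _ _ _ _; apply: small_sub (small_eq y) => // x [_ fl].
  apply: contrapT => xy; apply: fl; split => [[//|yx]|]; last by left.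
  by case: xy.
have [k' st] : exists k, forall A m r y, valid h l B A -> l < m -> wle A m r ->
    r + (size Ns).+1 <= h ->
    small (fun x : word => size x = m /\ flip (sys_lang^~ Ns) A y x)
          ((size y).+2 ^ k).
  by apply: IH => A /unamb[].
have [j Nj] := nptm_polytime N.
pose F : language -> language := sys_lang^~ Ns.
(* The exponent [j.+2] pays for the number of queries on a path, [j.+2 * k'] for the words
   exceptional for one of them, and 4 for the constants in [(2 * (2 * e)).+1], since
   [(size y).+2 ^ 4] is at least 16. *)
pose K := 4 + (j.+2 + j.+2 * k'); exists K => A m r y vA lm Ar.
rewrite /= => rh.
pose T := size y ^ j + j; pose e := T.+1 * T.+2 ^ k'.
have Ke : (2 * (2 * e)).+1 <= (size y).+2 ^ K.
  have TK := pow_comp_monomial (size y) j.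
  have Tk : T.+2 ^ k' <= (size y).+2 ^ (j.+2 * k') by rewrite expnM leq_exp_l.
  have eK : e <= (size y).+2 ^ (j.+2 + j.+2 * k').
    by rewrite expnD; apply: leq_mul => //; apply: ltnW.
  rewrite /K expnD.
  have : 0 < (size y).+2 ^ (j.+2 + j.+2 * k') by rewrite expn_gt0.
  have : 16 <= (size y).+2 ^ 4 by exact: (@leq_exp_l 2 (size y).+2 4 isT).
  nia.
have flips A' r' p : valid h l B A' -> wle A' m r' -> r' + (size Ns).+1 <= h ->
    size p <= T -> (forall w, w \in queries N tt (init N y :: p) -> size w <= size p) ->
    small (fun x : word => exists2 w, w \in queries N tt (init N y :: p) &
             size x = m /\ flip F A' w x) e.
  move=> vA' A'r' r'h pT qT.
  have : forall w, w \in queries N tt (init N y :: p) ->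
      small (fun x : word => size x = m /\ flip F A' w x) (T.+2 ^ k').
    move=> w /qT wp; apply: small_sub (st A' m r' w vA' lm A'r' r'h) => //.
    by rewrite leq_exp_l // !ltnS (leq_trans wp).
  move=> /small_exists_seq; apply: small_sub => //.
  rewrite leq_mul2r; apply/orP; right.
  by rewrite (leq_trans (size_queries _ _))//.
have path_size A' p : paths1 N (F A') y p -> size p <= T /\
    (forall w, w \in queries N tt (init N y :: p) -> size w <= size p).
  move=> [cp _ _]; split; first exact: Nj cp.
  by move=> w; apply: size_query cp.
have [yA|nyA] := pselect (lang1 N (F A) y).
  case: yA => p pA; have [pT qT] := path_size _ _ pA.
  apply: small_sub (flips A r p vA Ar _ pT qT); last by lia.
    move=> x [xm fl]; apply: contrapT => nex; apply: fl => /=; split=> _; exists p => //.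
    apply: paths1_flip pA => w wq; apply: contrapT => fl; apply: nex; exists w => //.
    by split=> // -[? ?]; apply: fl; split.
  by apply: leq_trans Ke; lia.
pose P (x : word) := size x = m /\ flip (sys_lang^~ (N :: Ns)) A y x.
(* The default [[::]] does not occur for [x] in [P]: as [y] is rejected on [A], an exceptional word
   makes it accepted. *)
pose pp x := xget [::] (paths1 N (F (addw A x)) y).
have ppP x : P x -> paths1 N (F (addw A x)) y (pp x).
  move=> [_ fl]; apply: xgetPex; apply: contrapT => nex.
  by apply: fl; split=> [[p pA]|//]; case: nex; exists p.
(* The first alternative covers the case that [z] destroys the path of [x]. Excluding the second
   handles coinciding paths: if [pp x = pp z], this path would accept already on [A]. *)
pose rel (x z : word) := exists2 w, w \in queries N tt (init N y :: pp x) &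
   flip F (addw A x) w z \/ flip F A w z.
have vx x : P x -> valid h l B (addw A x).
  by move=> [xm _]; apply: valid_addw vA lm xm Ar _; lia.
suff : small P (2 * (2 * e)).+1 by apply: small_sub.
apply: (small_tournament (r := rel)).
  move=> x Px; have [pT qT] := path_size _ _ (ppP _ Px).
  (* One machine fewer leaves room for one more word of length [m], so the induction hypothesis also
     covers [addw A x]. *)
  have f1 := flips _ _ _ (vx _ Px) (wle_addw x Ar) _ pT qT.
  have f2 := flips _ _ _ vA Ar _ pT qT.
  have {f1 f2} := small_or (f1 _) (f2 _); rewrite addnn -mul2n => h2.
  apply: small_sub (h2 _ _) => //; try lia.
  by move=> z [[zm _] [w wq [fl|fl]]]; [left|right]; exists w.
move=> x z Px Pz xz; apply: contrapT => /not_orP[nxz nzx].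
have ext u v : P u -> ~ rel u v -> paths1 N (F (addw (addw A u) v)) y (pp u).
  move=> Pu nuv; apply: paths1_flip (ppP _ Pu) => w wq.
  apply: contrapT => fl; apply: nuv; exists w => //; left => -[? ?].
  by apply: fl; split.
have vxz : valid h l B (addw (addw A x) z).
  by apply: valid_addw (vx _ Px) lm (proj1 Pz) (wle_addw x Ar) _; lia.
have [un _] := unamb _ vxz.
have epp : pp x = pp z.
  apply: (un y); first exact: ext.
  by rewrite -/(F _) addwC; apply: ext.
apply: nyA; exists (pp x); apply: (@paths1_flip _ _ (addw A z)).
  move=> w wq; apply: contrapT => fl; apply: nxz; exists w => //; by right.
by rewrite epp; apply: ppP.
Qed.

(** Only a word queried on the unique halting run can change the answer. *)
Lemma det_lang_stable (N : nptm unit) : deterministic N ->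
  exists k, forall A y, small (fun x : word => flip (lang1 N) A y x) ((size y).+2 ^ k).
Proof.
move=> det; have [j Nj] := nptm_polytime N; exists j.+2 => A y.
have [p cp hp] := halted_exists (fun=> A) y (nptm_polytime N).
apply: small_sub (small_mem (queries N tt (init N y :: p))).
  move=> x fl; apply: contrapT => /negP nx; apply: fl.
  have ag : agree_on (fun=> A) (fun=> addw A x) (init N y :: p).
    move=> [] w wq; split; first by left.
    by case=> // wx; move: nx; rewrite -wx wq.
  have cp' : computation N (fun=> addw A x) y p by apply: path_local ag cp.
  have hp' : halted N (fun=> addw A x) (last (init N y) p).
    rewrite -(halted_local (O := fun=> A)) //.
    by apply: agree_onS ag => c; rewrite inE => /eqP ->; apply: mem_last.
  split=> -[p' [c' h' f']]; exists p; split=> //.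
    by rewrite (det_halted_path det cp' hp' c' h').
  by rewrite (det_halted_path det cp hp c' h').
rewrite (leq_trans (size_queries _ _))//= (leq_trans _ (pow_comp_monomial _ _))//.
by rewrite !ltnS ltnW// ltnS; apply: Nj cp.
Qed.

(** * First changed answers *)

Lemma exp_dominates C D K l : exists2 n, l <= n & C * (D * n.+1) ^ K < 2 ^ n.
Proof.
(* With [n = 2 ^ (2 * u)] the left side is at most [2 ^ (W * (2 * u).+1)], and [2 * W <= u] makes
   this exponent smaller than [2 ^ u * 2 ^ u = n]. The summand [l] of [u] gives [l <= n]. *)
pose Q := C * D ^ K; pose W := Q + K; pose u := 2 * W + l; exists (2 ^ (2 * u)).
  by have := ltn_expl (2 * u) (ltnSn 1); rewrite /u; lia.
have -> : C * (D * (2 ^ (2 * u)).+1) ^ K = Q * (2 ^ (2 * u)).+1 ^ K.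
  by rewrite expnMn mulnA.
have h1 : (2 ^ (2 * u)).+1 <= 2 ^ (2 * u).+1.
  by have : 0 < 2 ^ (2 * u); rewrite ?expn_gt0// expnS; lia.
have h2 : Q <= 2 ^ Q by rewrite ltnW// ltn_expl.
apply: (@leq_ltn_trans (2 ^ (Q + (2 * u).+1 * K))).
  by rewrite expnD; apply: leq_mul => //; rewrite [leqRHS]expnM; apply: leq_exp_l.
rewrite ltn_exp2l//.
have hu : u < 2 ^ u by rewrite ltn_expl.
rewrite mul2n -addnn expnD.
have : Q + (u + u).+1 * K <= W * (2 * u).+1 by rewrite /W; nia.
have : 2 * W <= u by rewrite /u leq_addr.
nia.
Qed.

(* The map [(x, t) |-> (x with t at i, x i)] is an involution, so a random [x]
   is bad at [i] with probability at most [e / #|T|]. *)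
Lemma avoid_bad (I T : finType) (bad : I -> {ffun I -> T} -> bool) e :
  (forall i (x : {ffun I -> T}),
     #|[set t | bad i [ffun j => if j == i then t else x j]]%SET| <= e) ->
  #|I| * e < #|T| -> exists x, forall i, ~~ bad i x.
Proof.
move=> be eT; pose upd i (x : {ffun I -> T}) t : {ffun I -> T} :=
  [ffun j => if j == i then t else x j].
apply: contrapT => nx.
have allbad x : 1 <= \sum_(i : I) bad i x.
  apply: contrapT => h; apply: nx; exists x => i; apply/negP => bi.
  by apply: h; rewrite (bigD1 i)//= bi.
have badi i : (\sum_(x : {ffun I -> T}) bad i x) * #|T| <= #|{ffun I -> T}| * e.
  have -> : (\sum_(x : {ffun I -> T}) bad i x) * #|T| =
            \sum_(u : {ffun I -> T} * T) bad i u.1.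
    rewrite -(pair_bigA _ (fun x (t : T) => nat_of_bool (bad i x))) /= big_distrl /=.
    by apply: eq_bigr => x _; rewrite sum_nat_const mulnC.
  pose g (u : {ffun I -> T} * T) := (upd i u.1 u.2, u.1 i).
  have gK : involutive g.
    case=> x t; rewrite /g /=; congr pair; last by rewrite ffunE eqxx.
    by apply/ffunP => j; rewrite !ffunE; case: eqP => [->|].
  rewrite (reindex_inj (inv_inj gK)) /=.
  rewrite -(pair_bigA _ (fun x t => nat_of_bool (bad i (upd i x t)))) /=.
  rewrite -sum_nat_const; apply: leq_sum => x _; apply: leq_trans (be i x).
  by rewrite -sum1dep_card [leqRHS]big_mkcond; apply: leq_sum => t _; case: (bad _ _).
have F0 : 0 < #|{ffun I -> T}|.
  by rewrite card_ffun expn_gt0 (leq_ltn_trans _ eT).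
have : #|{ffun I -> T}| * #|T| <= #|I| * (#|{ffun I -> T}| * e).
  apply: (@leq_trans ((\sum_(x : {ffun I -> T}) \sum_(i : I) bad i x) * #|T|)).
    rewrite leq_mul2r; apply/orP; right.
    by rewrite -sum1_card; apply: leq_sum => x _; apply: allbad.
  rewrite exchange_big big_distrl /= -sum_nat_const.
  by apply: leq_sum => i _; apply: badi.
by rewrite mulnCA leq_pmul2l// leqNgt eT.
Qed.

(* [q S] lists the queries made by a fixed adaptive procedure on the set [S], and
   [a S] the answers.  If along [S], [i |: S], ... answers can only turn from no
   to yes, then for each [i] in [R] consider the first answer changed by adding
   [i].  Adding an [i] for which it comes latest makes the first changes for
   the other elements of [R] come strictly earlier. *)
Lemma few_first_changes (I : finType) (W : eqType) (q : {set I} -> seq W)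
    (a : {set I} -> W -> bool) :
  let ans S := [seq a S w | w <- q S] in
  (forall (S : {set I}) i t, i \notin S -> take t (ans S) = take t (ans (i |: S)%SET) ->
     take t.+1 (q S) = take t.+1 (q (i |: S)%SET)) ->
  (forall (S : {set I}) i w, i \notin S -> w \in q S -> a S w -> a (i |: S)%SET w) ->
  (forall (S : {set I}) i j w, i \notin S -> j \notin S -> i != j -> w \in q S ->
     ~~ a S w -> w \in q (i |: S)%SET -> a (i |: S)%SET w ->
     w \in q (j |: S)%SET -> a (j |: S)%SET w ->
     w \in q (j |: (i |: S))%SET -> False) ->
  forall t (S R : {set I}), [disjoint R & S]%B ->
    (forall j, j \in R -> take t (ans S) <> take t (ans (j |: S)%SET)) ->
    #|R| <= t.
Proof.
move=> ans same persist conflict.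
have sans S : size (ans S) = size (q S) by rewrite size_map.
(* When the first [t] answers agree, either the next ones agree as well or position [t] carries a
   common query with different answers. *)
have next S S' t : take t (ans S) = take t (ans S') ->
    take t.+1 (q S) = take t.+1 (q S') ->
    take t.+1 (ans S) = take t.+1 (ans S') \/
    exists w, [/\ w \in q S, w \in q S', t < size (q S), ohead (drop t (q S)) = Some w &
      ohead (drop t (q S')) = Some w] /\ a S w != a S' w.
  move=> ea eq.
  have se : size (take t.+1 (q S)) = size (take t.+1 (q S')) by rewrite eq.
  rewrite !size_take_min in se.
  have [tS|tS] := leqP (size (q S)) t.
    have tS' : size (q S') <= t by lia.
    by left; move: ea; rewrite !take_oversize ?sans// ltnW.
  have tS' : t < size (q S') by lia.
  have [w0 _] : exists w0 : W, w0 \in q S by case: (q S) tS => // w s; exists w; apply: mem_head.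
  have en : nth w0 (q S) t = nth w0 (q S') t.
    by rewrite -(nth_take w0 (ltnSn t)) eq nth_take.
  have [ae|ane] := eqVneq (a S (nth w0 (q S) t)) (a S' (nth w0 (q S) t)).
    left; rewrite !(take_nth true) ?sans// ea; congr rcons.
    by rewrite !(nth_map w0)// -en ae.
  right; exists (nth w0 (q S) t); split=> //; split=> //.
  - exact: mem_nth.
  - by rewrite en mem_nth.
  - by rewrite (drop_nth w0).
  - by rewrite (drop_nth w0)//= en.
elim=> [|t IH] S R RS diff.
  rewrite leqn0 cards_eq0; apply/set0Pn => -[j jR].
  by case: (diff j jR); rewrite !take0.
(* An [i] that keeps the first [t] answers has its first change at position [t], the latest
   possible. Without such an [i] the induction hypothesis applies to all of [R]. *)
have [[i iR ei]|nex] := pselect (exists2 i, i \in R &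
    take t (ans S) = take t (ans (i |: S)%SET)); last first.
  by apply: leqW; apply: (IH S) => // j jR ej; apply: nex; exists j.
have nS j : j \in R -> j \notin S by move=> jR; rewrite (disjointFr RS).
rewrite (cardsD1 i) iR add1n ltnS; apply: (IH (i |: S)%SET).
  apply/pred0P => k; rewrite /= !inE; case: eqP => //= _.
  by case kR: (k \in R) => //=; apply/negbTE/nS.
move=> j; rewrite !inE => /andP[ji jR] eij.
have jiS : j \notin (i |: S)%SET by rewrite !inE negb_or ji nS.
have ijS : i \notin (j |: S)%SET by rewrite !inE negb_or eq_sym ji nS.
(* A query changed by [j] before position [t] would turn to yes on [j |: S] and, by [persist], stay
   yes when [i] is added; but there the first [t] answers are those on [S]. *)
have ej : forall t', t' <= t -> take t' (ans S) = take t' (ans (j |: S)%SET).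
  elim=> [|t' IHt] t't; first by rewrite !take0.
  have e' := IHt (ltnW t't).
  have qe := same _ _ _ (nS _ jR) e'.
  have [//|[w [[wS wj tS hS hj] dj]]] := next _ _ _ e' qe.
  have up := persist _ _ _ (nS _ jR) wS.
  have up' := persist _ _ _ ijS wj.
  have eS : take t'.+1 (ans S) = take t'.+1 (ans (j |: (i |: S))%SET).
    by rewrite -(take_takel _ t't) ei eij take_takel.
  have : a S w = a (j |: (i |: S))%SET w.
    have e2 : take t' (ans S) = take t' (ans (i |: S)%SET).
      by rewrite -(take_takel _ (ltnW t't)) ei take_takel// ltnW.
    have e3 : take t' (ans (i |: S)%SET) = take t' (ans (j |: (i |: S))%SET).
      by rewrite -(take_takel _ (ltnW t't)) eij take_takel// ltnW.
    have qe2 := same _ _ _ (nS _ iR) e2.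
    have qe3 := same _ _ _ jiS e3.
    have nth0 : nth w (q S) t' = w.
      by move: hS; rewrite (drop_nth w tS) => -[].
    have st : t' < size (q (j |: (i |: S))%SET).
      have : size (take t'.+1 (q S)) = size (take t'.+1 (q (j |: (i |: S))%SET)).
        by rewrite qe2 qe3.
      by rewrite !size_take_min; lia.
    have nth3 : nth w (q (j |: (i |: S))%SET) t' = w.
      by rewrite -(nth_take w (ltnSn t')) -qe3 -qe2 nth_take.
    have := congr1 (fun s => nth true s t') eS.
    by rewrite !nth_take// !(nth_map w)// nth0 nth3.
  move=> ae; move: up up' dj; rewrite finset.setUCA -ae.
  case: (a S w) => [up _|_ up']; first by rewrite up.
  by case: (a (j |: S)%SET w) up' => // /(_ isT).
have {}ej := ej _ (leqnn t).
(* Now [i] and [j] both turn the same query, the one at position [t], from no to yes, and it is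
   still asked on [j |: (i |: S)], against [conflict]. *)
have [e|[w [[wS wi tS hS hi] di]]] := next _ _ _ ei (same _ _ _ (nS _ iR) ei).
  by case: (diff i iR).
have [e|[w' [[_ wj _ hS' hj] dj]]] := next _ _ _ ej (same _ _ _ (nS _ jR) ej).
  by case: (diff j jR).
have ww : w' = w by move: hS'; rewrite hS => -[].
subst w'.
have aS : ~~ a S w.
  by apply/negP => aS; move: di; rewrite aS (persist _ _ _ (nS _ iR) wS aS).
move: di dj; rewrite (negbTE aS); case ai: (a (i |: S)%SET w) => // _.
case aj: (a (j |: S)%SET w) => // _.
apply: (conflict S i j w) => //; try exact: nS; first by rewrite eq_sym.
have qe := same _ _ _ jiS eij.
have : w \in take t.+1 (q (i |: S)%SET).
  rewrite -(same _ _ _ (nS _ iR) ei) (take_nth w)// mem_rcons inE.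
  by move: hS; rewrite (drop_nth w tS) => -[->]; rewrite eqxx.
by rewrite qe => /mem_take.
Qed.

(** * Stages of the diagonalization *)

Definition same_length (A : language) : language :=
  [set w | exists2 z : word, size z = size w & A z].

(* Every 0 ends a word, so only words [1^m] are listed; the last one, possibly empty,
   has no end marker. *)
Fixpoint blocks (x : word) : seq word :=
  if x is b :: y then
    let ws := blocks y in
    if b then (true :: head [::] ws) :: behead ws else [::] :: ws
  else [:: [::]].

Definition test_language (A : language) : language :=
  [set x | exists2 w, w \in blocks x & same_length A w].

Lemma size_blocks x w : w \in blocks x -> size w <= size x.
Proof.
elim: x w => [|b x IH] w /=; first by rewrite inE => /eqP ->.
case: b; last by rewrite inE => /orP[/eqP ->|/IH/leqW].
rewrite inE => /orP[/eqP ->|wx]; last by rewrite leqW// IH// mem_behead.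
by case: (blocks x) IH => [|v vs] IH //=; rewrite ltnS IH// mem_head.
Qed.

Lemma blocks_nseq m x : blocks (nseq m true ++ false :: x) = nseq m true :: blocks x.
Proof. by elim: m => //= m ->. Qed.

Lemma blocks_nseq0 m : blocks (nseq m true) = [:: nseq m true].
Proof. by elim: m => //= m ->. Qed.

(** The input that lists the lengths [n + b] down to [n + 1]. The last block repeats [n + 1], for an
    empty one would test for a word of length 0, possibly in the segment already fixed. *)
Fixpoint probe (n b : nat) : word :=
  if b is b'.+1 then nseq (n + b) true ++ false :: probe n b' else nseq n.+1 true.

Lemma blocks_probe n b w : w \in blocks (probe n b) -> n < size w.
Proof.
elim: b => [|b IH]; first by rewrite blocks_nseq0 inE => /eqP ->; rewrite size_nseq.
by rewrite blocks_nseq inE => /orP[/eqP ->|/IH//]; rewrite size_nseq; lia.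
Qed.

Lemma mem_blocks_probe n b i : i < b -> nseq (n + i.+1) true \in blocks (probe n b).
Proof.
elim: b => [//|b IH]; rewrite blocks_nseq inE ltnS leq_eqVlt.
by move=> /orP[/eqP ->|/IH ->]; rewrite ?eqxx// orbT.
Qed.

Lemma size_probe n b : size (probe n b) <= b.+1 * (n + b).+1.
Proof.
elim: b => [|b IH] /=; first by rewrite size_nseq mul1n; lia.
rewrite size_cat size_nseq /=; nia.
Qed.

Lemma test_language_local n A A' :
  agree n A A' -> agree n (test_language A) (test_language A').
Proof.
suff half A1 A2 : agree n A1 A2 ->
    forall x, size x <= n -> test_language A1 x -> test_language A2 x.
  by move=> ag x xn; split; apply: half => //; apply: agree_sym.
move=> ag x xn [w wx [z zw Az]]; exists w => //; exists z => //.
by apply/(ag z) => //; rewrite zw (leq_trans (size_blocks wx)).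
Qed.

(** Two distinct accepting paths depend on a finite part of the oracle only. *)
Lemma unambiguous_closed A Ns :
  (forall n, exists2 A', agree n A A' & unambiguous A' Ns) -> unambiguous A Ns.
Proof.
elim: Ns => [//|N Ns IH] cl /=; split; last first.
  by apply: IH => n; have [A' ag [_ un]] := cl n; exists A'.
move=> y p p' pA pA'; have [k Nk] := nptm_polytime N.
have [g gP] := sys_lang_local Ns.
have [A' ag [un _]] := cl (g (size y ^ k + k)); apply: (un y).
  apply: accepting_paths_local (pA); case: pA => cp _ _.
  by apply: (agree_on_agree cp (Nk _ _ _ cp)) => _; apply: gP.
apply: accepting_paths_local (pA'); case: pA' => cp _ _.
by apply: (agree_on_agree cp (Nk _ _ _ cp)) => _; apply: gP.
Qed.

(** * The reduction as a property of the oracle *)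

Section Reduction.
Variables (Ns : seq (nptm unit)) (N : nptm unit) (M : nptm bool) (c : nat).

Definition oracles (A : language) (i : bool) : language :=
  if i then A else lang1 N (sys_lang A Ns).

(** The language of [N] stands in for the promise problem, and uniqueness of accepting paths on the
    queries asked for the promise, so that only the oracle and the machines remain. *)
Definition reduces (A : language) : Prop :=
  [/\ unambiguous A Ns,
    forall x p, computation M (oracles A) x p ->
      size (queries M false (init M x :: p)) <= c /\
      forall w, w \in queries M false (init M x :: p) ->
        is_subset1 (paths1 N (sys_lang A Ns) w)
    & accepted M (oracles A) = test_language A].

Lemma oracles_local : exists g : nat -> nat, forall n A A',
  agree (g n) A A' -> forall i, agree n (oracles A i) (oracles A' i).
Proof.
have [g gP] := sys_lang_local (N :: Ns).
exists (fun n => maxn n (g n)) => n A A' ag [].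
  by apply: agreeW ag; apply: leq_maxl.
by apply: gP; apply: agreeW ag; apply: leq_maxr.
Qed.

(** For a fixed input each clause concerns computations of bounded length, so it is inherited from
    an oracle that agrees with [A] far enough. Conversely, a failure is forced by a finite initial
    segment. *)
Lemma reduces_closed A : (forall n, exists2 A', agree n A A' & reduces A') -> reduces A.
Proof.
move=> cl; have [g gP] := oracles_local; have [k Mk] := nptm_polytime M.
have [g' gP'] := sys_lang_local Ns; have [k' Nk] := nptm_polytime N.
split.
- by apply: unambiguous_closed => n; have [A' ag []] := cl n; exists A'.
- move=> x p cp; set T := size x ^ k + k; set T' := T ^ k' + k'.
  have [A' ag [_ red _]] := cl (maxn (g T) (g' T')).
  have ag1 : agree (g T) A A' by apply: agreeW ag; apply: leq_maxl.
  have ag2 : agree (g' T') A A' by apply: agreeW ag; apply: leq_maxr.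
  have cp' : computation M (oracles A') x p.
    apply: path_local (cp); apply: (agree_on_agree cp (Mk _ _ _ cp)) => i.
    exact: gP.
  have [sq un] := red x p cp'; split=> // w wq p1 p2 pa1 pa2.
  have wT : size w <= T by exact: leq_trans (size_query cp wq) (Mk _ _ _ cp).
  have mv q : paths1 N (sys_lang A Ns) w q -> paths1 N (sys_lang A' Ns) w q.
    move=> qa; apply: accepting_paths_local (qa); case: qa => cq _ _.
    apply: (agree_on_agree cq (n := T')) => [|_]; last exact: gP'.
    by rewrite (leq_trans (Nk _ _ _ cq))// leq_add2r leq_exp_l.
  by apply: (un w wq); apply: mv.
- apply/seteqP; suff : forall x, accepted M (oracles A) x <-> test_language A x.
    by move=> e; split=> x /e.
  move=> x; set T := size x ^ k + k.
  have [A' ag [_ _ e]] := cl (maxn (g T) (size x)).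
  have ag1 : agree (g T) A A' by apply: agreeW ag; apply: leq_maxl.
  have ag2 : agree (size x) A A' by apply: agreeW ag; apply: leq_maxr.
  have a1 := accepted_local Mk (gP _ _ _ ag1) (leqnn (size x)).
  have a2 := test_language_local ag2 (leqnn (size x)).
  by apply: (iff_trans a1); rewrite e; apply: iff_sym.
Qed.

Section NoReduction.
Variables (h l : nat) (B : language).
Hypothesis h_gt0 : 0 < h.
Hypothesis B_short : forall w, B w -> size w <= l.
Hypothesis B_wle : forall m, wle B m h.
Hypothesis M_det : deterministic M.
Hypothesis reducesV : forall A, valid h l B A -> reduces A.
Hypothesis stable : exists k, forall A m y, valid h l B A -> l < m -> wle A m 0 ->
  small (fun x : word => size x = m /\ flip (sys_lang^~ Ns) A y x)
        ((size y).+2 ^ k).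

Let D (A : language) := sys_lang A Ns.
Let I : finType := 'I_c.+1.

(** * The oracles obtained by adding a generic word for some of [c + 1] lengths *)

Section Cube.
Variable n : nat.
Hypothesis ln : l <= n.
Let T : finType := n.-tuple bool.

(** The padding gives each coordinate a length of its own and leaves [2 ^ n] choices for the
    word. *)
Definition emb (i : I) (z : T) : word := val z ++ nseq i.+1 true.

Lemma size_emb i z : size (emb i z) = n + i.+1.
Proof. by rewrite size_cat size_nseq size_tuple. Qed.

Lemma emb_inj i : injective (emb i).
Proof.
move=> z z' /eqP; rewrite eqseq_cat ?size_tuple// => /andP[/eqP e _].
exact: val_inj.
Qed.

Definition cube (x : {ffun I -> T}) (S : {set I}) : language :=
  [set w | B w \/ exists2 i, i \in S & w = emb i (x i)].

Lemma cubeU1 x i S : cube x (i |: S)%SET = addw (cube x S) (emb i (x i)).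
Proof.
apply/seteqP; split=> w.
  case=> [Bw|[j]]; first by left; left.
  by rewrite in_setU1 => /orP[/eqP -> ->|jS ->]; [right|left; right; exists j].
case=> [[Bw|[j jS ->]]|->]; first by left.
  by right; exists j; rewrite // in_setU1 jS orbT.
by right; exists i; rewrite // in_setU1 eqxx.
Qed.

Lemma cube0 x : cube x finset.set0 = B.
Proof.
by apply/seteqP; split=> w; [case=> // -[i]; rewrite finset.in_set0|left].
Qed.

Lemma wle_cube0 x (S : {set I}) i : i \notin S -> wle (cube x S) (n + i.+1) 0.
Proof.
move=> iS; apply: small_sub (small_false 0) => // w [[/B_short wl wn|]].
  by lia.
move=> [j jS ->]; rewrite size_emb => /addnI[] /val_inj ij.
by rewrite -ij jS in iS.
Qed.

Lemma valid_cube x S : valid h l B (cube x S).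
Proof.
split.
- exists (n + c.+1) => w [/B_short|[i _ ->]]; first by lia.
  by rewrite size_emb leq_add2l.
- move=> w wl; split; first by left.
  by case=> // -[i _ wi]; move: wl; rewrite wi size_emb; lia.
- move=> m; have [ml|lm] := leqP m l.
    apply: small_sub (@B_wle m) => // w [[Bw|[i _ ->]]] //.
    by rewrite size_emb; lia.
  have [[i im]|nex] := pselect (exists i : I, n + i.+1 = m).
    apply: small_sub (small_eq (emb i (x i))) => // w [[/B_short|[j _ ->]]].
      by lia.
    by rewrite size_emb -im => /addnI[] /val_inj ->.
  apply: small_sub (small_false 0) => // w [[/B_short|[j _ ->]]]; first by lia.
  by rewrite size_emb => jm; apply: nex; exists j.
Qed.

(** Oracles that omit coordinate [i] ignore [x i], so the words to be avoided at [i] form a fixed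
    set while [x i] is resampled as in [avoid_bad]. *)
Lemma cube_upd (x : {ffun I -> T}) i (S : {set I}) t : i \notin S ->
  cube [ffun j => if j == i then t else x j] S = cube x S.
Proof.
move=> iS; apply/seteqP; split=> w [Bw|[j jS]]; try by left.
  rewrite ffunE; case: eqP => [ji|_ ->]; first by rewrite -ji jS in iS.
  by right; exists j.
move=> ->; right; exists j => //; rewrite ffunE; case: eqP => // ji.
by rewrite -ji jS in iS.
Qed.

(** For each [i] few words are hit by any pair of sets omitting [i], so [avoid_bad] applies. Two
    sets occur because a path chosen on one oracle is later examined on another. *)
Lemma generic_exists (QA QD : language -> seq word) a d e :
  (forall A, valid h l B A -> size (QA A) <= a) ->
  (forall A, valid h l B A -> size (QD A) <= d) ->
  (forall A A' m y, valid h l B A -> valid h l B A' -> l < m -> wle A' m 0 ->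
     y \in QD A -> small (fun z : word => size z = m /\ flip D A' y z) e) ->
  #|I| * (#|{set I}| * (#|{set I}| * (a + d * e))) < 2 ^ n ->
  exists x : {ffun I -> T}, forall (S S' : {set I}) i, i \notin S -> i \notin S' ->
    emb i (x i) \notin QA (cube x S) /\
    forall y, y \in QD (cube x S) -> ~ flip D (cube x S') y (emb i (x i)).
Proof.
move=> QAa QDd flips big.
pose hit (x : {ffun I -> T}) (i : I) (z : word) := exists S S' : {set I}, [/\ i \notin S, i \notin S' &
  z \in QA (cube x S) \/
  exists2 y, y \in QD (cube x S) & size z = n + i.+1 /\ flip D (cube x S') y z].
have hit_small x i : small (hit x i) (#|{set I}| * (#|{set I}| * (a + d * e))).
  apply: small_exists => S; apply: small_exists => S'.
  have [iS|iS] := boolP (i \in S).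
    by apply: small_sub (small_false 0) => // z [].
  have [iS'|iS'] := boolP (i \in S').
    by apply: small_sub (small_false 0) => // z [].
  have vS := valid_cube x S; have vS' := valid_cube x S'.
  have sD : small (fun z : word => exists2 y, y \in QD (cube x S) &
      size z = n + i.+1 /\ flip D (cube x S') y z) (size (QD (cube x S)) * e).
    apply: small_exists_seq => y yQ; apply: (flips _ _ _ _ vS vS') => //; first by lia.
    exact: wle_cube0.
  apply: small_sub (small_or (small_mem (QA (cube x S))) sD); first by move=> z [].
  by rewrite leq_add ?QAa// leq_mul2r QDd ?orbT.
have [x xP] : exists x : {ffun I -> T}, forall i, ~~ `[< hit x i (emb i (x i)) >].
  apply: (avoid_bad (bad := fun i x => `[< hit x i (emb i (x i)) >])) _.
    move=> i x; rewrite cardE -(size_map (emb i)).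
    apply: (hit_small x i); first by rewrite (map_inj_uniq (@emb_inj i)) enum_uniq.
    move=> z /mapP[t]; rewrite mem_enum finset.inE => /asboolP[S [S' [iS iS']]].
    by rewrite !cube_upd// ffunE eqxx => ht ->; exists S, S'.
  by rewrite card_tuple card_bool.
exists x => S S' i iS iS'; split.
  apply/negP => zQ; move/negP: (xP i); apply; apply/asboolP.
  by exists S, S'; split=> //; left.
move=> y yQ fl; move/negP: (xP i); apply; apply/asboolP.
by exists S, S'; split=> //; right; exists y => //; rewrite size_emb.
Qed.

Section Generic.
Variables (comp : language -> seq (config M)) (pi : language -> word -> seq (config N)).
Let X := probe n c.+1.
Let qs A := queries M false (init M X :: comp A).
Let QA A := queries M true (init M X :: comp A).
Let QD A := flatten [seq queries N tt (init N w :: pi A w) | w <- qs A].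
Hypothesis comp_path : forall A, computation M (oracles A) X (comp A).
Hypothesis comp_halted : forall A, halted M (oracles A) (last (init M X) (comp A)).
Hypothesis piP : forall A w, lang1 N (D A) w -> paths1 N (D A) w (pi A w).
Variable x : {ffun I -> T}.
Hypothesis generic : forall (S S' : {set I}) i, i \notin S -> i \notin S' ->
    emb i (x i) \notin QA (cube x S) /\
    forall y, y \in QD (cube x S) -> ~ flip D (cube x S') y (emb i (x i)).

Lemma pi_flip (S S' : {set I}) i w : i \notin S -> i \notin S' -> w \in qs (cube x S) ->
  paths1 N (D (cube x (i |: S')%SET)) w (pi (cube x S) w) <->
  paths1 N (D (cube x S')) w (pi (cube x S) w).
Proof.
move=> iS iS' wq.
have ag v : v \in queries N tt (init N w :: pi (cube x S) w) ->
    (D (cube x (i |: S')%SET) v <-> D (cube x S') v).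
  move=> vq; have [_ /(_ v) nf] := generic iS iS'.
  rewrite cubeU1; apply: contrapT; apply: nf.
  by apply/flattenP; eexists; [apply: map_f wq|].
by split; apply: paths1_flip => v vq; [|apply: iff_sym]; apply: ag.
Qed.

(** Each of the [c + 1] words puts the probe into the test language, so adding it to [B] must change
    one of at most [c] answers; [few_first_changes] allows at most [c] such words. *)
Lemma no_generic_reduction : False.
Proof.
pose a (S : {set I}) w := `[< lang1 N (D (cube x S)) w >].
pose q S := qs (cube x S).
have transcripts (S : {set I}) i : i \notin S ->
    (forall t, take t [seq a S w | w <- q S] =
               take t [seq a (i |: S)%SET w | w <- q (i |: S)%SET] ->
       take t.+1 (q S) = take t.+1 (q (i |: S)%SET)) /\
    ([seq a S w | w <- q S] = [seq a (i |: S)%SET w | w <- q (i |: S)%SET] ->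
       comp (cube x S) = comp (cube x (i |: S)%SET)).
  move=> iS; have ag j w : j != false -> w \in queries M j (init M X :: comp (cube x S)) ->
      (oracles (cube x S) j w <-> oracles (cube x (i |: S)%SET) j w).
    case: j => //= _ wq; rewrite cubeU1; split; first by left.
    case=> // we; have [/negP] := generic iS iS.
    by rewrite -we.
  exact: det_transcripts M_det ag (comp_path _) (comp_halted _) (comp_path _) (comp_halted _).
have persist (S : {set I}) i w : i \notin S -> w \in q S -> a S w ->
    paths1 N (D (cube x (i |: S)%SET)) w (pi (cube x S) w).
  by move=> iS wq /asboolP/piP pw; apply/(pi_flip iS iS wq).
have unique (S : {set I}) w : w \in q S -> is_subset1 (paths1 N (D (cube x S)) w).
  have [_ red _] := reducesV (valid_cube x S).
  by have [_ +] := red _ _ (comp_path (cube x S)) => /[apply].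
have few := @few_first_changes I _ q a (fun S i t iS => (transcripts S i iS).1 t).
suff : #|[set: I]%SET| <= c by rewrite cardsT card_ord ltnn.
apply: (few _ _ c finset.set0).
- move=> S i w iS wq aw; apply/asboolP; exists (pi (cube x S) w); exact: persist.
- move=> S i j w iS jS ij wS nw wi ai wj aj wij.
  have ji : j != i by rewrite eq_sym.
  have jiS : j \notin (i |: S)%SET by rewrite !finset.inE negb_or ji.
  have ijS : i \notin (j |: S)%SET by rewrite !finset.inE negb_or ij.
  (* Both paths survive on [j |: (i |: S)], hence coincide. The common path accepts on [i |: S] and,
     having been chosen on [j |: S], asks nothing for which the word at [i] is exceptional; so it
     accepts on [S], where [w] is rejected. *)
  have e : pi (cube x (i |: S)%SET) w = pi (cube x (j |: S)%SET) w.
    apply: (unique (j |: (i |: S))%SET w wij); first exact: persist.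
    by rewrite finset.setUCA; apply: persist.
  move/asboolP: nw; apply; exists (pi (cube x (j |: S)%SET) w).
  apply/(pi_flip ijS iS wj); rewrite -e; apply: piP; exact/asboolP.
- by rewrite disjoint_sym; apply/pred0P => k; rewrite /= finset.in_set0.
move=> j _; rewrite !take_oversize ?size_map; last 2 first.
- by have [_ red _] := reducesV (valid_cube x (j |: finset.set0)%SET); case: (red X _ (comp_path _)).
- by have [_ red _] := reducesV (valid_cube x finset.set0); case: (red X _ (comp_path _)).
have j0 : j \notin finset.set0 by rewrite finset.in_set0.
move=> /((transcripts _ _ j0).2) ec.
have [_ _ e0] := reducesV (valid_cube x finset.set0).
have [_ _ ej] := reducesV (valid_cube x (j |: finset.set0)%SET).
have : accepted M (oracles (cube x (j |: finset.set0)%SET)) X.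
  rewrite ej; exists (nseq (n + j.+1) true); first exact: mem_blocks_probe.
  exists (emb j (x j)); first by rewrite size_emb size_nseq.
  by right; exists j; rewrite // !finset.inE eqxx.
move=> [p [cp hp fp]].
have : accepted M (oracles (cube x finset.set0)) X.
  exists (comp (cube x finset.set0)); split=> //; rewrite ec.
  by rewrite (det_halted_path M_det (comp_path _) (comp_halted _) cp hp).
rewrite e0 => -[w /blocks_probe nw [z zw]]; rewrite cube0 => /B_short.
by rewrite zw leqNgt (leq_ltn_trans ln nw).
Qed.

End Generic.
End Cube.

Lemma no_reduction : False.
Proof.
have [kM Mk] := nptm_polytime M; have [kN Nk] := nptm_polytime N.
have [kD Dst] := stable.
pose K := (kM.+2 + (kM.+2 + kM.+2 * kN.+2 + kM.+2 * kN.+2 * kD)).+1.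
pose C := #|I| * (#|{set I}| * #|{set I}|).
(* [C] counts the triples of a coordinate and two sets; [(c.+2 * c.+3 + 2) * n.+1] bounds
   [(size X).+2]. In [K] the outer successor turns the sum of the two contributions into a
   product. *)
have [n ln big] := exp_dominates C (c.+2 * c.+3 + 2) K l.
pose X := probe n c.+1.
have ex_comp A : exists p, computation M (oracles A) X p /\
    halted M (oracles A) (last (init M X) p).
  by have [p cp hp] := halted_exists (oracles A) X (nptm_polytime M); exists p.
have [comp compP] := boolp.choice ex_comp.
(* The default [[::]] is a computation too, so the time bound covers rejected [w]. *)
pose pi A w := xget [::] (paths1 N (D A) w).
have piP A w : lang1 N (D A) w -> paths1 N (D A) w (pi A w).
  by move=> [p pw]; apply: xgetPex; exists p.
have pi_comp A w : computation N (fun=> D A) w (pi A w).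
  by rewrite /pi; case: xgetP => [p _ []|].
pose TM := size X ^ kM + kM; pose TN := TM ^ kN + kN.
pose qs A := queries M false (init M X :: comp A).
have q_size A i w : w \in queries M i (init M X :: comp A) -> size w <= TM.
  move=> wq; have [cp _] := compP A.
  exact: leq_trans (size_query cp wq) (Mk _ _ _ cp).
have q_num A i : size (queries M i (init M X :: comp A)) <= TM.+1.
  have [cp _] := compP A; apply: leq_trans (size_queries _ _) _.
  by rewrite /= ltnS; apply: Mk cp.
have pi_size A w : w \in qs A -> size (pi A w) <= TN.
  move=> /q_size wT; apply: leq_trans (Nk _ _ _ (pi_comp A w)) _.
  by rewrite leq_add2r leq_exp_l.
have [] := @generic_exists n ln (fun A => queries M true (init M X :: comp A))
  (fun A => flatten [seq queries N tt (init N w :: pi A w) | w <- qs A])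
  TM.+1 (TM.+1 * TN.+1) (TN.+2 ^ kD).
- by move=> A _; apply: q_num.
- move=> A _; rewrite size_flatten /shape -map_comp sumnE big_map.
  apply: (@leq_trans (\sum_(w <- qs A) TN.+1)).
    rewrite big_seq [leqRHS]big_seq; apply: leq_sum => w wq /=.
    by apply: leq_trans (size_queries _ _) _; rewrite /= ltnS pi_size.
  by rewrite big_const_seq count_predT iter_addn addn0 mulnC leq_mul2r q_num orbT.
- move=> A A' m y vA vA' lm A'm /flattenP[_ /mapP[w wq ->] yq].
  apply: small_sub (Dst A' m y vA' lm A'm) => //.
  rewrite leq_exp_l// !ltnS; apply: leq_trans (size_query (pi_comp A w) yq) _.
  exact: pi_size.
- apply: leq_ltn_trans big.
  set Y := (size X).+2.
  have YX : Y <= (c.+2 * c.+3 + 2) * n.+1.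
    have := size_probe n c.+1; rewrite -/X /Y; nia.
  have eM : TM.+2 <= Y ^ kM.+2 by apply: pow_comp_monomial.
  have eN : TN.+2 <= Y ^ (kM.+2 * kN.+2).
    by apply: leq_trans (pow_comp_monomial _ _) _; rewrite expnM leq_exp_l.
  have eD : TN.+2 ^ kD <= Y ^ (kM.+2 * kN.+2 * kD).
    by rewrite [leqRHS]expnM leq_exp_l.
  have e2 : TM.+1 * TN.+1 * TN.+2 ^ kD <=
      Y ^ (kM.+2 + kM.+2 * kN.+2 + kM.+2 * kN.+2 * kD).
    rewrite expnD; apply: leq_mul eD; rewrite expnD.
    by apply: leq_mul; apply: ltnW.
  have eK : TM.+1 + TM.+1 * TN.+1 * TN.+2 ^ kD <= Y ^ K.
    rewrite /K expnS expnD.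
    have Y2 : 2 <= Y by [].
    have p1 : 0 < Y ^ kM.+2 by rewrite expn_gt0.
    have p2 : 0 < Y ^ (kM.+2 + kM.+2 * kN.+2 + kM.+2 * kN.+2 * kD).
      by rewrite expn_gt0.
    set U := Y ^ kM.+2 in eM p1 *.
    set V := Y ^ (kM.+2 + kM.+2 * kN.+2 + kM.+2 * kN.+2 * kD) in e2 p2 *.
    apply: (@leq_trans (U + V)); first by rewrite leq_add// ltnW.
    apply: (@leq_trans (2 * (U * V))); last by rewrite leq_mul2r Y2 orbT.
    by rewrite mul2n -addnn leq_add// ?leq_pmulr ?leq_pmull.
  rewrite (mulnA #|{set I}|) (mulnA #|I|) -/C leq_mul2l; apply/orP; right.
  by apply: leq_trans eK _; apply: leq_exp_l.
move=> x gen.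
apply: (@no_generic_reduction n ln comp pi) gen => // A; by case: (compP A).
Qed.

End NoReduction.
End Reduction.

#[local] Arguments successors : simpl never.
#[local] Arguments step : simpl never.
Lemma small_enum (T : eqType) (P : T -> Prop) n : small P n ->
  exists s : seq T, size s <= n /\ forall x, P x -> x \in s.
Proof.
move=> Pn; apply: contrapT => nex.
suff [s [us sP sn]] : exists s : seq T, [/\ uniq s, forall x, x \in s -> P x & size s = n.+1].
  by have := Pn s us sP; rewrite sn ltnn.
elim: n.+1 => [|k [s [us sP sk]]]; first by exists [::].
have [x Px xs] : exists2 x, P x & x \notin s.
  apply: contrapT => nx; apply: nex; exists s; split; first exact: Pn.
  by move=> x Px; apply/negP => xs; apply: nx; exists x => //; apply/negP.
exists (x :: s); rewrite /= us xs sk; split=> // y.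
by rewrite inE => /orP[/eqP ->|/sP].
Qed.

Lemma small_card (T : eqType) (P : set T) n : small P n -> (P #<= `I_n)%card.
Proof.
move=> /small_enum[[|x0 s] [sn sP]].
  apply: card_le_trans (_ : (set0 #<= `I_n)%card); last exact: card_ge0.
  by apply: subset_card_le => x /sP.
apply: card_le_trans (_ : (`I_(size (x0 :: s)) #<= `I_n)%card); last by rewrite card_le_II.
apply: card_le_trans (card_image_le (nth x0 (x0 :: s)) _).
apply: subset_card_le => x /sP xs; exists (index x (x0 :: s)); last exact: nth_index.
by move: xs; rewrite -index_mem.
Qed.

(** * Machines for the upper bound *)

Definition load (l : seq (cell 0)) (u : word) : tape 0 :=
  if u is b :: y then (l, Some (inl b), [seq Some (inl c) | c <- y]) else (l, None, [::]).

Lemma load_right l b u :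
  write_move (load l (b :: u)) (Some (inl b), Rightward) = load (Some (inl b) :: l) u.
Proof. by case: u. Qed.

Section Guess.

Local Notation q0 := (@Ordinal 4 0 isT).
Local Notation q1 := (@Ordinal 4 1 isT).
Local Notation q2 := (@Ordinal 4 2 isT).
Local Notation q3 := (@Ordinal 4 3 isT).

(* In state 0 the machine guesses a bit for each input bit; in state 1 it queries
   the guessed word; state 2 accepts and state 3 rejects. *)
Definition guess : otm unit :=
  @OTM unit 4 0 0 q0 [set q2]%SET
    [ffun q => if q == q1 then Some (tt, (q2, q3)) else None]
    [ffun qs : 'I_4 * {ffun 'I_1 -> cell 0} =>
      if qs.1 == q0 then
        if qs.2 ord0 is Some _ then
          [set (q0, [ffun=> (qs.2 ord0, Rightward)], Some b, None) | b : bool]%SET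
        else [set (q1, [ffun=> (None, Stay)], None, None)]%SET
      else finset.set0].

Definition guessing l u w : config guess := (q0, [ffun=> load l u], w, [::]).
Definition asking l w : config guess := (q1, [ffun=> load l [::]], w, [::]).
Definition answered l (a : bool) : config guess := (if a then q2 else q3, [ffun=> load l [::]], [::], [::]).

Lemma init_guess x : init guess x = guessing [::] x [::].
Proof.
by rewrite /init /guessing; congr (_, _, _, _); apply/ffunP => i; rewrite !ffunE ord1; case: x.
Qed.

Lemma guess_guessing O l b u w c' :
  reflect (exists b', c' = guessing (Some (inl b) :: l) u (rcons w b'))
          (c' \in successors guess O (guessing l (b :: u) w)).
Proof.
have actE b' : act (guessing l (b :: u) w) (q0, [ffun=> (Some (inl b), Rightward)], Some b', None)
    = guessing (Some (inl b) :: l) u (rcons w b').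
  rewrite /act /guessing /= cats1; congr (_, _, _, _).
  by apply/ffunP => i; rewrite !ffunE load_right.
rewrite /successors /guessing /= !ffunE /=.
apply: (iffP mapP) => [[m]|[b' ->]].
  rewrite mem_enum => /imsetP[b' _ ->] ->; exists b'; exact: actE.
exists (q0, [ffun=> (Some (inl b), Rightward)], Some b', None); last exact/esym/actE.
by rewrite mem_enum; apply/imsetP; exists b'.
Qed.

Lemma guess_end O l w : successors guess O (guessing l [::] w) = [:: asking l w].
Proof.
rewrite /successors /guessing /= !ffunE /= enum_set1 /= cats0.
by congr [:: (_, _, _, _)]; apply/ffunP => i; rewrite !ffunE.
Qed.

Lemma guess_asking O l w :
  successors guess O (asking l w) = [:: answered l `[< O tt w >]].
Proof. by rewrite /successors /asking /= ffunE. Qed.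

Lemma guess_answered O l a : successors guess O (answered l a) = [::].
Proof.
by case: a; rewrite /successors /answered /= !ffunE /= enum_set0.
Qed.

Definition guess_run := fix run l (u w z : word) : seq (config guess) :=
  match u, z with
  | b :: u', b' :: z' =>
      guessing (Some (inl b) :: l) u' (rcons w b') ::
      run (Some (inl b) :: l) u' (rcons w b') z'
  | _, _ => [:: asking l w; answered l true]
  end.

Lemma guess_polytime : polytime guess.
Proof.
exists 2 => O x p; rewrite /computation init_guess => pp.
suff : size p <= size x + 2 by move=> h; apply: leq_trans h _; rewrite leq_add2r; nia.
elim: x [::] [::] p pp => [|b u IH] l w [|c1 p] //= /andP[].
  rewrite /step guess_end inE => /eqP ->.
  case: p => [|c2 p] //= /andP[]; rewrite /step guess_asking inE => /eqP ->.
  by case: p => [|c3 p] //= /andP[]; rewrite /step guess_answered.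
by move=> /guess_guessing[b' ->] /IH.
Qed.

(** The guessed word determines the accepting run, so there are at most as many accepting paths as
    words of the oracle of the input's length. *)
Lemma guess_accepts O l u w p :
  [/\ path (step guess O) (guessing l u w) p, halted guess O (last (guessing l u w) p)
    & cstate (last (guessing l u w) p) \in final guess] <->
  exists z : word, [/\ size z = size u, O tt (w ++ z) & p = guess_run l u w z].
Proof.
elim: u l w p => [|b u IH] l w p; split.
- case: p => [|c1 p] /= []; first by rewrite /halted guess_end.
  case/andP; rewrite /step guess_end inE => /eqP ->.
  case: p => [|c2 p] /=; first by rewrite /halted guess_asking.
  case/andP; rewrite /step guess_asking inE => /eqP ->.
  case: p => [_ _ /=|c3 p /andP[]]; last by rewrite /step guess_answered.
  rewrite /answered /cstate /= finset.inE; case: asboolP => // Ow _.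
  by exists [::]; rewrite cats0.
- case=> z [/size0nil -> + ->]; rewrite cats0 => Ow.
  have e : `[< O tt w >] = true by apply/asboolP.
  rewrite /= /step guess_end guess_asking e !inE !eqxx /halted guess_answered; split=> //.
- case: p => [|c1 p] /= [].
    move=> _; rewrite /halted => /nilP e.
    have : guessing (Some (inl b) :: l) u (rcons w true) \in
        successors guess O (guessing l (b :: u) w) by apply/guess_guessing; exists true.
    by rewrite e.
  move=> /andP[/guess_guessing[b' ->] pp] hp fp.
  have [z [sz Oz ->]] := (IH _ _ _).1 (And3 pp hp fp).
  by exists (b' :: z); rewrite /= sz -cat_rcons.
case=> -[|b' z] [] // [sz] Oz ->.
have [|pp hp fp] := (IH (Some (inl b) :: l) (rcons w b') (guess_run (Some (inl b) :: l) u (rcons w b') z)).2.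
  by exists z; rewrite cat_rcons.
by split=> //=; rewrite pp andbT; apply/guess_guessing; exists b'.
Qed.

Definition guess_tm : nptm unit := NPTM guess_polytime.

Lemma same_length_UPle h A : (forall m, wle A m h) -> UPle h A (same_length A).
Proof.
move=> Ah; exists guess_tm; split.
  move=> x; apply: card_le_trans (small_card (@Ah (size x))).
  apply: card_le_trans (card_image_le (guess_run [::] x [::]) _).
  apply: subset_card_le => p; rewrite /paths1 /accepting_paths /computation /= init_guess.
  by move=> /guess_accepts[z [sz Az ->]]; exists z.
apply/seteqP; split=> x.
  case=> p; rewrite /accepting_paths /computation /= init_guess.
  by move=> /guess_accepts[z [sz Az _]]; exists z.
case=> z sz Az; exists (guess_run [::] x [::] z).
rewrite /accepting_paths /computation /= init_guess.
by apply/guess_accepts; exists z.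
Qed.

End Guess.

Section Transducer.

Local Notation p0 := (@Ordinal 2 0 isT).
Local Notation p1 := (@Ordinal 2 1 isT).

(** A 0 becomes the end marker of a listed word, in accordance with [blocks]. *)
Definition emit (b : bool) : option bool := if b then Some true else None.

Definition splitter : otm void :=
  @OTM void 2 0 0 p0 finset.set0 [ffun=> None]
    [ffun qs : 'I_2 * {ffun 'I_1 -> cell 0} =>
      if qs.1 == p0 then
        match qs.2 ord0 with
        | Some (inl b) => [set (p0, [ffun=> (Some (inl b), Rightward)], None, Some (emit b))]%SET
        | Some (inr _) => finset.set0
        | None => [set (p1, [ffun=> (None, Stay)], None, Some None)]%SET
        end
      else finset.set0].

Definition splitting l u o : config splitter := (p0, [ffun=> load l u], [::], o).
Definition finished l o : config splitter := (p1, [ffun=> load l [::]], [::], o).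

Lemma init_splitter x : init splitter x = splitting [::] x [::].
Proof.
by rewrite /init /splitting; congr (_, _, _, _); apply/ffunP => i; rewrite !ffunE ord1; case: x.
Qed.

Lemma splitter_splitting O l b u o :
  successors splitter O (splitting l (b :: u) o) = [:: splitting (Some (inl b) :: l) u (rcons o (emit b))].
Proof.
rewrite /successors /splitting /= !ffunE /= enum_set1 /= cats1.
by congr [:: (_, _, _, _)]; apply/ffunP => i; rewrite !ffunE load_right.
Qed.

Lemma splitter_end O l o : successors splitter O (splitting l [::] o) = [:: finished l (rcons o None)].
Proof.
rewrite /successors /splitting /= !ffunE /= enum_set1 /= cats1.
by congr [:: (_, _, _, _)]; apply/ffunP => i; rewrite !ffunE.
Qed.

Lemma splitter_finished O l o : successors splitter O (finished l o) = [::].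
Proof. by rewrite /successors /finished /= !ffunE /= enum_set0. Qed.

Lemma splitter_polytime : polytime splitter.
Proof.
exists 1 => O x p; rewrite /computation init_splitter expn1.
elim: x [::] [::] p => [|b u IH] l o [|c1 p] //= /andP[].
  rewrite /step splitter_end inE => /eqP ->.
  by case: p => [|c2 p] //= /andP[]; rewrite /step splitter_finished.
by rewrite /step splitter_splitting inE => /eqP -> /IH.
Qed.

Lemma splitter_deterministic : deterministic splitter.
Proof.
move=> qs; rewrite ffunE; case: ifP => _; last by rewrite cards0.
by case: (qs.2 ord0) => [[b|i]|]; rewrite ?cards1 ?cards0.
Qed.

Lemma encode_blocks u : encode_words (blocks u) = rcons [seq emit b | b <- u] None.
Proof.
elim: u => [//|b u IH] /=; rewrite -IH.
by case: b => //=; case: u {IH} => [//|[] u] //=; case: (blocks u).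
Qed.

Lemma splitter_run O l u o : exists2 p, path (step splitter O) (splitting l u o) p &
  exists l', last (splitting l u o) p = finished l' (o ++ rcons [seq emit b | b <- u] None).
Proof.
elim: u l o => [|b u IH] l o.
  exists [:: finished l (rcons o None)]; first by rewrite /= /step splitter_end inE eqxx.
  by exists l; rewrite /= cats1.
have [p pp [l' lp]] := IH (Some (inl b) :: l) (rcons o (emit b)).
exists (splitting (Some (inl b) :: l) u (rcons o (emit b)) :: p).
  by rewrite /= /step splitter_splitting inE eqxx.
by exists l'; rewrite /= lp cat_rcons.
Qed.

Lemma blocks_computable : polytime_computable blocks.
Proof.
exists (NPTM splitter_polytime); first exact: splitter_deterministic.
move=> x; have [p pp [l' lp]] := splitter_run (fun=> set0) [::] x [::].
exists p; rewrite /computation /= init_splitter lp; split=> //.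
  by rewrite /halted splitter_finished.
by rewrite encode_blocks.
Qed.

End Transducer.

Lemma test_language_Rdtt h A : (forall m, wle A m h) -> Rdtt (UPle h A) (test_language A).
Proof.
move=> Ah; exists (same_length A); first exact: same_length_UPle.
by exists blocks; first exact: blocks_computable.
Qed.

(** * The oracle *)

Section Countability.
Variable I : finType.

Let program (n t e : nat) : countType :=
  ('I_n * {set 'I_n} * {ffun 'I_n -> option (I * ('I_n * 'I_n))} *
   {ffun 'I_n * {ffun 'I_t.+1 -> cell e} ->
     {set 'I_n * {ffun 'I_t.+1 -> cell e * move} * option bool * option (option bool)}})%type.
Let program_e n t : countType := {e : nat & program n t e}.
Let program_te n : countType := {t : nat & program_e n t}.
Let program_nte : countType := {n : nat & program_te n}.

Lemma otm_countable : exists f : otm I -> nat, injective f.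
Proof.
pose g (M : otm I) : program_nte :=
  existT program_te (nstates M) (existT (program_e (nstates M)) (ntapes M)
    (existT (program (nstates M) (ntapes M)) (nextra M)
      (start M, final M, query M, delta M))).
pose g' (c : program_nte) : otm I :=
  let: existT n (existT t (existT e (s, f, q, d))) := c in OTM s f q d.
have gK : cancel g g' by case.
exists (fun M => pickle (g M)) => M M' /(pcan_inj pickleK).
exact: can_inj gK _ _.
Qed.

Lemma nptm_countable : exists f : nptm I -> nat, injective f.
Proof.
have [f f_inj] := otm_countable; exists (fun N => f (machine N)).
case=> [M pM] [M' pM'] /f_inj /= e; subst M'.
by rewrite (Prop_irrelevance pM pM').
Qed.

End Countability.

Definition candidate : Type := (seq (nptm unit) * nptm unit * nptm bool * nat)%type.

Lemma candidate_countable : exists f : candidate -> nat, injective f.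
Proof.
have [f f_inj] := nptm_countable unit; have [g g_inj] := nptm_countable bool.
exists (fun u : candidate =>
  let: (Ns, N, M, c) := u in pickle ([seq f N' | N' <- Ns], f N, g M, c)).
move=> [[[Ns N] M] c] [[[Ns' N'] M'] c'] /(pcan_inj pickleK)[].
by move=> /(inj_map f_inj) -> /f_inj -> /g_inj -> ->.
Qed.

Lemma det_unambiguous (N : nptm unit) A y : deterministic N -> is_subset1 (paths1 N A y).
Proof. by move=> det p p' [c h _] [c' h' _]; apply: det_halted_path c h c' h'. Qed.

Section Diagonalization.
Variable h : nat.
Hypothesis h_gt0 : 0 < h.

(** The second case represents [relP], the class at level 0, for [h = 1]: a deterministic machine is
    an unambiguous system of length one. *)
Definition admissible (Ns : seq (nptm unit)) : Prop :=
  (1 < h /\ size Ns = h - 1) \/ exists2 N : nptm unit, deterministic N & Ns = [:: N].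

(** If no finite extension were decisive, [reduces_closed] would give [reduces] for every valid
    oracle, contrary to [no_reduction]. *)
Lemma defeat Ns N (M : nptm bool) c l B : admissible Ns -> deterministic M ->
  (forall w, B w -> size w <= l) -> (forall m, wle B m h) ->
  exists A n, [/\ valid h l B A, l < n, forall w, A w -> size w <= n &
    forall A', agree n A A' -> ~ reduces Ns N M c A'].
Proof.
move=> adm det Bl Bh; apply: contrapT => nex.
have red A : valid h l B A -> reduces Ns N M c A.
  move=> vA; apply: reduces_closed => n0; apply: contrapT => nA.
  have [[n An] _ _] := vA; apply: nex; exists A, (maxn l.+1 (maxn n n0)); split=> //.
  - by rewrite leq_max ltnSn.
  - by move=> w /An wn; rewrite !leq_max wn orbT.
  move=> A' ag rA'; apply: nA; exists A' => //; apply: agreeW ag.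
  by rewrite !leq_max leqnn !orbT.
have unamb A : valid h l B A -> unambiguous A Ns by move=> /red[].
apply: (no_reduction h_gt0 Bl Bh det red).
case: adm => [[h1 sNs]|[N0 det0 eNs]].
  (* With no word of length [m] present, the budget [0 + (size Ns).+1 <= h] is met with equality. *)
  have [k st] := sys_lang_stable unamb; exists k => A m y vA lm A0.
  by apply: st vA lm A0 _; lia.
have [k st] := det_lang_stable det0; exists k => A m y _ _ _; rewrite eNs.
by apply: small_sub (leqnn _) (st A y) => x [].
Qed.

(** Stage [s] fixes a finite oracle up to a length bound so as to defeat the candidate with code
    [s]; the limit agrees with each stage up to its bound. *)
Lemma oracle_exists : exists A : language, (forall m, wle A m h) /\
  forall Ns N (M : nptm bool) c, admissible Ns -> deterministic M -> ~ reduces Ns N M c A.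
Proof.
have [code code_inj] := candidate_countable.
pose ok (u : language * nat) := (forall w, u.1 w -> size w <= u.2) /\ forall m, wle u.1 m h.
have ext (su : nat * (language * nat)) : exists u' : language * nat, ok su.2 ->
    [/\ ok u', su.2.2 < u'.2, agree su.2.2 su.2.1 u'.1 &
      forall Ns N (M : nptm bool) c, code (Ns, N, M, c) = su.1 ->
        admissible Ns -> deterministic M ->
        forall A, agree u'.2 u'.1 A -> ~ reduces Ns N M c A].
  case: su => s [B l] /=.
  have [[[[[Ns N] M] c] /= [cs [adm det]]]|nex] := pselect (exists u : candidate,
      code u = s /\ admissible u.1.1.1 /\ deterministic u.1.2); last first.
    (* A stage without a candidate still raises the bound, so that every length is fixed
       eventually. *)
    exists (B, l.+1) => -[Bl Bh]; split=> //=.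
      by split=> // w /Bl /leqW.
    by move=> Ns N M c cs adm det; case: nex; exists (Ns, N, M, c).
  have [okB|nok] := pselect (ok (B, l)); last by exists (B, l).
  have [Bl Bh] := okB; have [A [n [[_ ag Ah] ln An red]]] := defeat N c adm det Bl Bh.
  exists (A, n) => _; split=> // Ns' N' M' c' cs' _ _.
  have e : (Ns', N', M', c') = (Ns, N, M, c) by apply: code_inj; rewrite cs'.
  by case: e => -> -> -> ->; apply: red.
have [next nextP] := boolp.choice ext.
pose st := fix st s := if s is s'.+1 then next (s', st s') else (set0 : language, 0).
have st_ok s : ok (st s).
  elim: s => [|s IH] /=; first by split=> // m; apply: small_sub (leqnn _) (@small_false _ h) => w [].
  by case: (nextP (s, st s) IH).
have st_next s := nextP (s, st s) (st_ok s).
have st_ge s : s <= (st s).2.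
  by elim: s => // s IH; apply: leq_ltn_trans IH _; case: (st_next s).
have st_mono s d : (st s).2 <= (st (s + d)).2 /\ agree (st s).2 (st s).1 (st (s + d)).1.
  elim: d => [|d [le ag]]; first by rewrite addn0; split=> //; apply: agree_refl.
  rewrite addnS; have [_ lt ag' _] := st_next (s + d); split.
    by apply: leq_trans le _; apply: ltnW.
  by apply: agree_trans ag _; apply: agreeW ag'.
pose A : language := [set w | exists s, (st s).1 w].
have A_agree s : agree (st s).2 (st s).1 A.
  move=> w ws; split; first by exists s.
  case=> t tw; have [ts|st'] := leqP t s.
    have [tl _] := st_ok t; have [_ /(_ w (tl _ tw))[+ _]] := st_mono t (s - t).
    by rewrite subnKC//; apply.
  have [_ /(_ w ws)[_]] := st_mono s (t - s).
  by rewrite subnKC ?(ltnW st')//; apply.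
exists A; split.
  move=> m; have [_ /(_ m)] := st_ok m; apply: small_sub => // w [Aw wm]; split=> //.
  by apply/(A_agree m) => //; rewrite wm.
move=> Ns N M c adm det.
have [_ _ _ /(_ Ns N M c erefl adm det)] := st_next (code (Ns, N, M, c)).
by apply; apply: (A_agree (code (Ns, N, M, c)).+1).
Qed.

End Diagonalization.

(** All queries satisfy the promise, and there [pyes Pi] agrees with the language of [N]; hence [M]
    runs alike with either oracle. *)
Lemma Rsb_reduces A Ns (N : nptm unit) (M : nptm bool) c (Pi : promise_problem) L :
  unambiguous A Ns ->
  (forall x, pyes Pi x -> exists! p, paths1 N (sys_lang A Ns) x p) ->
  (forall x, pno Pi x -> paths1 N (sys_lang A Ns) x = set0) ->
  (forall x p, computation M (with_promise A Pi) x p ->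
     size (queries M false (init M x :: p)) <= c /\
     forall w, w \in queries M false (init M x :: p) -> (pyes Pi `|` pno Pi) w) ->
  accepted M (with_promise A Pi) = L -> L = test_language A ->
  reduces Ns N M c A.
Proof.
move=> unamb yes no smart acc LA.
have promise w : (pyes Pi `|` pno Pi) w ->
    is_subset1 (paths1 N (sys_lang A Ns) w) /\ (pyes Pi w <-> lang1 N (sys_lang A Ns) w).
  case=> [yw|nw].
    have [p [pw pu]] := yes w yw; split; last by split=> // _; exists p.
    by move=> p1 p2 /pu <- /pu <-.
  have e := no w nw; split; first by rewrite e.
  split=> [yw|[p]]; last by rewrite -/(paths1 _ _ _) e.
  by have : (pyes Pi `&` pno Pi) w by []; rewrite pdisjoint.
have ag x p : computation M (with_promise A Pi) x p ->
    agree_on (with_promise A Pi) (oracles Ns N A) (init M x :: p).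
  move=> cp [] w wq //.
  by have [_ /(_ w wq) /promise[_]] := smart x p cp.
(* By induction the run so far is one with [Pi], so its last query satisfies the promise and the
   next step is the same for both oracles. *)
have comp x p : computation M (oracles Ns N A) x p -> computation M (with_promise A Pi) x p.
  elim/last_ind: p => [//|p d IH]; rewrite /computation !rcons_path => /andP[cp sd].
  have {}cp := IH cp; apply/andP; split=> //; rewrite /step (@successors_local _ _ _ (oracles Ns N A)) //.
  by apply: agree_onS (ag _ _ cp) => d'; rewrite inE => /eqP ->; apply: mem_last.
split=> //.
  move=> x p /comp cp; have [sq qs] := smart x p cp; split=> // w /qs.
  by move=> /promise[].
rewrite -LA -acc; apply/seteqP; split=> x [p pa]; exists p.
  apply: accepting_paths_local (pa); apply/agree_on_sym/ag.
  by case: pa => /comp.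
by apply: accepting_paths_local (pa); apply: ag; case: pa.
Qed.

Theorem theorem4p16 : forall h : nat, 1 <= h ->
  exists A : language,
    ~ (Rdtt (UPle h A) `<=` Rsb A (PromiseUP (USigma (h - 1) A))).
Proof.
move=> h h_gt0; have [A [Ah defeated]] := oracle_exists h_gt0.
exists A => sub; have := sub _ (test_language_Rdtt Ah).
move=> [Pi [D DU [N [yes no]]] [c [M [det smart acc]]]].
suff [Ns [adm unamb eD]] : exists Ns, [/\ admissible h Ns, unambiguous A Ns & sys_lang A Ns = D].
  apply: (defeated Ns N M c adm det).
  by apply: (Rsb_reduces unamb _ _ smart acc erefl); rewrite eD.
have [h1|h1] := leqP h 1.
  have e : h - 1 = 0 by apply/eqP.
  move: DU; rewrite e => -[N0 [det0 eN0]]; exists [:: N0]; split=> //.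
    by right; exists N0.
  by split=> // y; apply: det_unambiguous.
have e : h - 1 = (h - 2).+1 by lia.
move: DU; rewrite e /= => -[Ns [unamb eD]]; exists Ns; split=> //.
by left; rewrite size_tuple e.
Qed.
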